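(* $F_1^\circ$ is a regular subsemigroup of $F_1$, it is weakly generated by the set of idempotents $\{[xx'],[x'x]\}$, and it is isomorphic to $FI_2$.
   Context: A semigroup is regular if for each element $s$ there is $t$ with $sts=s$. A regular semigroup $S$ is weakly generated by a subset if no proper regular subsemigroup of $S$ contains that subset. **The set $G$.** Let $A=\{1,x,x'\}$ (three distinct symbols) with involution $'$ exchanging $x$ and $x'$ and fixing $1$. A 5-tuple is written $g=(g^{l},g^{la},g^{c},g^{ra},g^{r})$. Put $g_{xx'}=(1,1,x,x',1)$, $G_{1,e}=\{g_{xx'}\}$ and, for $i\ge 2$, $G_{i,e}=\{(g,(g^{la})',g^l,(g^{ra})',g),\ (g,(g^{ra})',g^l,(g^{la})',g) : g\in G_{i-1,e}\}$. Put $G_{1,d}=G_{2,d}=\emptyset$ and $G_i=G_{i,e}\cup G_{i,d}$, where recursively for $i\ge 3$, $G_{i,d}$ is the set of all $g\in G_{i-1}\times A\times G_{i-2}\times A\times G_{i-1}$ such that: (1) $g^l\neq g^r$; (2) $(g^c,g^{la})$ equals $((g^l)^l,((g^l)^{la})')$ or $((g^l)^r,((g^l)^{ra})')$; (3) $(g^c,g^{ra})$ equals $((g^r)^l,((g^r)^{la})')$ or $((g^r)^r,((g^r)^{ra})')$. Let $G^5=\bigcup_{i\ge1}G_i$, $G'=G^5\cup\{1\}$, $G=G^5\cup A$. The height is $\upsilon(1)=0$ and $\upsilon(g)=i$ for $g\in G_i$. **The semigroups $F_1^1$ and $F_1$.** For $g\in G^5$ with $\upsilon(g)\ge2$ let $g^L=(g^{la})'g^lg^{la}$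 and $g^R=(g^{ra})'g^rg^{ra}$, words in the free semigroup $G^+$. Let $\rho$ be the smallest congruence on $G^+$ containing the pairs $(xx'x,x)$, $(x'xx',x')$, $(g_{xx'},xx')$; the pairs $(1g,g)$, $(g1,g)$ for $g\in G$; the pairs $(g^2,g)$ for $g\in G'$; and, for every $g\in G^5$ with $\upsilon(g)\ge 2$, the pairs $(g^cg^Lg,g)$, $(gg^Rg^c,g)$ and $(g^rg^{ra}g(g^{la})'g^l,\ g^rg^{ra}g^c(g^{la})'g^l)$. Write $[u]$ for the $\rho$-class of $u$. Then $F_1^1=G^+/\rho$ is a monoid with identity $[1]$, and $F_1=F_1^1\setminus\{[1]\}$ is a subsemigroup. **Mountains.** For $g_1\in G'$, $g\in G^5$, $a\in A$: $g_1ag$ is left anchored if $(g_1,a)\in\{(g^l,g^{la}),(g^r,g^{ra})\}$; $gag_1$ is right anchored if $(g_1,a)\in\{(g^l,(g^{la})'),(g^r,(g^{ra})')\}$. A landscape is a word $u=g_0a_1g_1\cdots a_ng_n$ ($n\ge0$, $g_j\in G'$, $a_j\in A$) in which every $g_{i-1}a_ig_i$ is left anchored or right anchored. A river of $u$ is a letter $g_i$ ($0<i<n$) with $\upsilon(g_{i-1})=\upsilon(g_{i+1})=\upsilon(g_i)+1$. A nontrivial mountain is a landscape with $n\geq 1$, $g_0=g_n=1$ and no rivers. **The semigroup $F_1^\circ$.** Let $G_1^\circ=\{g_{xx'}\}$; $G_2^\circ=\{g_{2,e,1},g_{2,e,2}\}$ with $g_{2,e,1}=(g_{xx'},1,1,x,g_{xx'})$,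 $g_{2,e,2}=(g_{xx'},x,1,1,g_{xx'})$; $G_3^\circ$ the set of the four 5-tuples $(p,a,g_{xx'},a,q)$ with $\{p,q\}=\{g_{2,e,1},g_{2,e,2}\}$ and $a\in\{1,x'\}$; and $G_{i+1}^\circ=\{g\in G_{i+1,d}: g^l,g^r\in G_i^\circ\}$ for $i\ge3$. Let $G^\circ=\bigcup_{i\ge1}G_i^\circ$. Let $M^\circ$ be the set of all nontrivial mountains $g_0a_1g_1\cdots g_{2n-1}a_{2n}g_{2n}$ such that (a) every $g_i$ lies in $G^\circ\cup\{1\}$ and (b) if $\upsilon(g_i)=1$ then $a_{i+1}=(a_i)'$. Put $F_1^\circ=\{[u]: u\in M^\circ\}\subseteq F_1$. **The semigroup $FI_2$.** For a triple $h=(a,b,c)$ write $h^r=a$, $h^c=b$, $h^l=c$. Let $e,f,1$ be distinct symbols, $H_0=\{1\}$, $H_1=\{(1,e,1),(1,f,1)\}$, where $(1,e,1)$ and $(1,f,1)$ are identified with $e$ and $f$. For $i>1$ let $H_i$ be the set of all $h\in H_{i-1}\times H_{i-2}\times H_{i-1}$ with $h^l\neq h^r$ and $h^c\in\{(h^l)^l,(h^l)^r\}\cap\{(h^r)^l,(h^r)^r\}$. Let $H=\bigcup_{i\ge0}H_i$, and let $\varrho$ be the smallest congruence on the free semigroup $H^+$ containing $(1h,h),(h1,h),(h^2,h)$ for all $h\in H$ (here $h^2$ is the word $hh$) and $(h^ch^lh,h)$, $(hh^rh^c,h)$, $(h^rh^chh^ch^l,\,h^rh^ch^l)$ for all $h\in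 H_i$ with $i\ge2$. Then $FI_2=(H^+/\varrho)\setminus\{1\varrho\}$, a semigroup. *)

(* Defs.v *)
From HB Require Import structures.
From mathcomp Require Import all_boot.
From mathcomp Require Import boolp classical_sets functions.

Set Implicit Arguments.
Unset Strict Implicit.
Unset Printing Implicit Defensive.

Local Open Scope classical_set_scope.
Local Open Scope quotient_scope.
Local Open Scope group_scope.

Section Subsemigroups.
Variable M : semigroupType.
Implicit Types S T X : set M.

Definition subsemigroup S := forall s t, S s -> S t -> S (s * t).

Definition regular S := forall s, S s -> exists2 t, S t & s * t * s = s.

Definition regular_subsemigroup S := subsemigroup S /\ regular S.

Definition weakly_generated S X :=
  X `<=` S /\
  forall T, regular_subsemigroup T -> T `<=` S -> X `<=` T -> T = S.

Definition idempotent_set X := forall s, X s -> s * s = s.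

End Subsemigroups.

(* [S] and [T] are the carriers of subsemigroups of [M] and [N]; the values of
   [f] outside [S] are irrelevant. *)
Definition isomorphic (M N : semigroupType) (S : set M) (T : set N) :=
  exists2 f : M -> N, set_bij S T f &
    forall s t, S s -> S t -> f (s * t) = f s * f t.

Section FreeSemigroup.
Variable L : choiceType.

Record word := Word { letters :> seq L; _ : letters != [::] }.

HB.instance Definition _ := [isSub for letters].
HB.instance Definition _ := [Choice of word by <:].

Definition mkword (a : L) (s : seq L) : word := @Word (a :: s) isT.

Fact cat_word_subproof (u v : word) : letters u ++ letters v != [::].
Proof. by case: u => -[]. Qed.

Definition cat_word (u v : word) := Word (cat_word_subproof u v).

Fact cat_wordA : associative cat_word.
Proof. by move=> u v w; apply/val_inj; rewrite /= catA. Qed.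

HB.instance Definition _ := isSemigroup.Build word cat_wordA.

Lemma letters_mul (u v : word) : letters (u * v) = letters u ++ letters v.
Proof. by []. Qed.

Lemma WordE a s (i : a :: s != [::]) : Word i = mkword a s.
Proof. exact/val_inj. Qed.

Lemma mkword_mul a s b t :
  mkword a s * mkword b t = mkword a (s ++ b :: t).
Proof. exact/val_inj. Qed.

End FreeSemigroup.

Section GeneratedCongruence.
Variables (S : semigroupType) (R : S -> S -> Prop).

Definition congruence (E : S -> S -> Prop) :=
  [/\ forall a, E a a, forall a b, E a b -> E b a,
      forall a b c, E a b -> E b c -> E a c &
      forall a b c, E a b -> E (c * a) (c * b) /\ E (a * c) (b * c)].

Definition gen_congruence (a b : S) :=
  forall E, congruence E -> (forall u v, R u v -> E u v) -> E a b.

Lemma gen_congruence_congruence : congruence gen_congruence.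
Proof.
split=> [a|a b ab|a b c ab bc|a b c ab].
- by move=> E [].
- by move=> E cE RE; case: (cE) => _ + _ _; apply; apply: ab.
- by move=> E cE RE; case: (cE) => _ _ + _; apply; [apply: ab|apply: bc].
- by split=> E cE RE; case: (cE) => _ _ _ /(_ a b c (ab E cE RE)) [].
Qed.

Lemma gen_congruence_incl a b : R a b -> gen_congruence a b.
Proof. by move=> Rab E _; apply. Qed.

Definition gen_congruenceb : rel S := fun a b => `[< gen_congruence a b >].

Fact gen_congruenceb_equiv : equiv_class_of gen_congruenceb.
Proof.
have [r s t _] := gen_congruence_congruence.
split=> [a|a b|b a c]; rewrite /gen_congruenceb.
- exact/asboolP.
- by apply: asbool_equiv_eq; split; apply: s.
- by move=> /asboolP ab /asboolP bc; apply/asboolP; apply: t bc.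
Qed.

Canonical gen_congruence_equiv := EquivRelPack gen_congruenceb_equiv.

Definition quotient := {eq_quot gen_congruence_equiv}.
HB.instance Definition _ := Choice.on quotient.
HB.instance Definition _ := Quotient.on quotient.

Definition class (a : S) : quotient := \pi_quotient a.

Lemma classP a b : class a = class b <-> gen_congruence a b.
Proof.
rewrite /class; split=> [/eqP|ab].
  by rewrite (eqmodE gen_congruence_equiv) => /asboolP.
by apply/eqP; rewrite (eqmodE gen_congruence_equiv); apply/asboolP.
Qed.

Lemma class_repr (c : quotient) : class (repr c) = c.
Proof. by rewrite /class reprK. Qed.

Definition mul_quotient (c d : quotient) := class (repr c * repr d).

Lemma class_mulE a b : mul_quotient (class a) (class b) = class (a * b).
Proof.
have [_ _ t m] := gen_congruence_congruence.
have cR c : gen_congruence (repr (class c)) c by apply/classP; rewrite class_repr.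
apply/classP; apply: (t _ (a * repr (class b))).
  exact: (m _ _ _ (cR a)).2.
exact: (m _ _ _ (cR b)).1.
Qed.

Fact mul_quotientA : associative mul_quotient.
Proof.
move=> c d e; rewrite -[c]class_repr -[d]class_repr -[e]class_repr.
by rewrite !class_mulE mulgA.
Qed.

HB.instance Definition _ := isSemigroup.Build quotient mul_quotientA.

Lemma class_mul a b : class (a * b) = class a * class b.
Proof. by rewrite -class_mulE. Qed.

End GeneratedCongruence.

(* A letter [e] with [e a ~ a ~ a e] for all letters [a] is an identity. *)
Section PresentedMonoid.
Variables (L : choiceType) (R : word L -> word L -> Prop) (e : L).
Hypothesis Rl : forall a, R (mkword e [:: a]) (mkword a [::]).
Hypothesis Rr : forall a, R (mkword a [:: e]) (mkword a [::]).

Lemma presented_mul1 : left_id (class R (mkword e [::])) mul.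
Proof.
move=> c; rewrite -(class_repr c) -class_mul; apply/classP => E cE RE.
case: (repr c) => -[//|a s] i; case: (cE) => _ _ _ Em.
have Ea : E (mkword e [::] * mkword a [::]) (mkword a [::]).
  by rewrite mkword_mul; exact: RE (Rl a).
rewrite WordE; case: s i => [|b s] _ //.
by have [_] := Em _ _ (mkword b s) Ea; rewrite -mulgA mkword_mul.
Qed.

Lemma presented_mulr1 : right_id (class R (mkword e [::])) mul.
Proof.
move=> c; rewrite -(class_repr c) -class_mul; apply/classP => E cE RE.
case: (repr c) => s; case: (cE) => _ _ _ Em.
case/lastP: s => [//|s a] i.
have Ea : E (mkword a [::] * mkword e [::]) (mkword a [::]).
  by rewrite mkword_mul; exact: RE (Rr a).
case: s i => [|b s] /= i; rewrite WordE //.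
have [+ _] := Em _ _ (mkword b s) Ea.
by rewrite mulgA mkword_mul cats1.
Qed.

(* If no defining relation identifies a power of [e] with another word, then
   the nonidentity elements form a subsemigroup. *)
Hypothesis Re : forall u v, R u v ->
  all (pred1 e) (letters u) = all (pred1 e) (letters v).

Lemma presented_nonidentity : subsemigroup (~` [set class R (mkword e [::])]).
Proof.
have inv u v : class R u = class R v ->
    all (pred1 e) (letters u) = all (pred1 e) (letters v).
  move/classP/(_ (fun u v => all (pred1 e) (letters u) = all (pred1 e) (letters v))).
  apply=> [|a b /Re//]; split=> // [a b c -> //|a b c ab].
  by rewrite !letters_mul !all_cat ab.
move=> s t; rewrite -(class_repr s) -(class_repr t) -class_mul => /= s1 _.
move=> /inv; rewrite letters_mul all_cat /= eqxx => /andP[+ _].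
case: (repr s) s1 => -[//|a w] i; rewrite WordE => s1 /andP[/eqP ea aw].
apply: s1; rewrite {}ea; elim: w aw {i} => //= b w IHw /andP[/eqP-> /IHw eq1].
have -> : mkword e (e :: w) = mkword e [::] * mkword e w by rewrite mkword_mul.
by rewrite class_mul presented_mul1.
Qed.

End PresentedMonoid.

Inductive A := A1 | Ax | Ax'.

Definition invA (a : A) := match a with A1 => A1 | Ax => Ax' | Ax' => Ax end.

(* [tup l la c ra r] is the 5-tuple (l, la, c, ra, r). *)
Inductive term :=
  | atom of A
  | tup of term & A & term & A & term.

Coercion atom : A >-> term.

HB.instance Definition _ := gen_eqMixin term.
HB.instance Definition _ := gen_choiceMixin term.

(* On atoms the five projections have junk values. *)
Definition gl (g : term) := if g is tup l _ _ _ _ then l else atom A1.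
Definition gla (g : term) := if g is tup _ la _ _ _ then la else A1.
Definition gc (g : term) := if g is tup _ _ c _ _ then c else atom A1.
Definition gra (g : term) := if g is tup _ _ _ ra _ then ra else A1.
Definition gr (g : term) := if g is tup _ _ _ _ r then r else atom A1.

Definition gxx' := tup A1 A1 Ax Ax' A1.

Inductive Ge : nat -> term -> Prop :=
  | Ge_base : Ge 1 gxx'
  | Ge_step1 i g : Ge i g ->
      Ge i.+1 (tup g (invA (gla g)) (gl g) (invA (gra g)) g)
  | Ge_step2 i g : Ge i g ->
      Ge i.+1 (tup g (invA (gra g)) (gl g) (invA (gla g)) g).

Inductive Gd : nat -> term -> Prop :=
  | Gd_tup i p a c b q :
      G_ i.+2 p -> G_ i.+1 c -> G_ i.+2 q ->
      p <> q ->
      (c, a) = (gl p, invA (gla p)) \/ (c, a) = (gr p, invA (gra p)) ->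
      (c, b) = (gl q, invA (gla q)) \/ (c, b) = (gr q, invA (gra q)) ->
      Gd i.+3 (tup p a c b q)
with G_ : nat -> term -> Prop :=
  | G_e i g : Ge i g -> G_ i g
  | G_d i g : Gd i g -> G_ i g.

Definition G5 : set term := [set g | exists i, G_ i g].
Definition G' : set term := G5 `|` [set atom A1].
Definition G : set term := G5 `|` range atom.

(* Junk on the atoms [Ax] and [Ax'], which have no height. *)
Fixpoint height (g : term) : nat := if g is tup l _ _ _ _ then (height l).+1 else 0.

Lemma height_Ge i g : Ge i g -> height g = i.
Proof. by elim=> //= j h _ ->. Qed.

Lemma height_G i g : G_ i g -> height g = i.
Proof.
elim: g i => [a|p IHp a c _ b q _] i Gg; inversion Gg as [? ? Ge_g|? ? Gd_g].
- exact: height_Ge.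
- by inversion Gd_g.
- exact: height_Ge.
- inversion Gd_g as [k ? ? ? ? ? Gp]; subst => /=.
  by rewrite (IHp k.+2).
Qed.

Definition gL (g : term) : seq term := [:: atom (invA (gla g)); gl g; atom (gla g)].
Definition gR (g : term) : seq term := [:: atom (invA (gra g)); gr g; atom (gra g)].

(* The defining pairs are written as sequences of terms, all of whose entries
   lie in [G]; [relG] pulls them back to words over the alphabet [G]. *)
Inductive rhoG : seq term -> seq term -> Prop :=
  | rhoG_x : rhoG [:: atom Ax; atom Ax'; atom Ax] [:: atom Ax]
  | rhoG_x' : rhoG [:: atom Ax'; atom Ax; atom Ax'] [:: atom Ax']
  | rhoG_xx' : rhoG [:: gxx'] [:: atom Ax; atom Ax']
  | rhoG_1l g : G g -> rhoG [:: atom A1; g] [:: g]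
  | rhoG_1r g : G g -> rhoG [:: g; atom A1] [:: g]
  | rhoG_idem g : G' g -> rhoG [:: g; g] [:: g]
  | rhoG_L g : G5 g -> 2 <= height g -> rhoG (gc g :: gL g ++ [:: g]) [:: g]
  | rhoG_R g : G5 g -> 2 <= height g -> rhoG (g :: gR g ++ [:: gc g]) [:: g]
  | rhoG_sandwich g : G5 g -> 2 <= height g ->
      rhoG [:: gr g; atom (gra g); g; atom (invA (gla g)); gl g]
           [:: gr g; atom (gra g); gc g; atom (invA (gla g)); gl g].

Notation letterG := (set_type G).

Definition relG (u v : word letterG) :=
  rhoG (map val (letters u)) (map val (letters v)).

Notation F11 := (quotient relG).

Fact atom_G a : atom a \in G.
Proof. by apply/mem_set; right; exists a. Qed.

Definition latom (a : A) : letterG := exist _ (atom a) (atom_G a).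

Definition clsG (u : word letterG) : F11 := class relG u.

Definition one_F11 : F11 := clsG (mkword (latom A1) [::]).

Definition F1 : set F11 := ~` [set one_F11].

Definition cls_xx' : F11 := clsG (mkword (latom Ax) [:: latom Ax']).
Definition cls_x'x : F11 := clsG (mkword (latom Ax') [:: latom Ax]).

Definition left_anchored (h : term) (a : A) (g : term) :=
  [/\ G' h, G5 g & (h, a) = (gl g, gla g) \/ (h, a) = (gr g, gra g)].

Definition right_anchored (g : term) (a : A) (h : term) :=
  [/\ G5 g, G' h &
      (h, a) = (gl g, invA (gla g)) \/ (h, a) = (gr g, invA (gra g))].

(* The word g_0 a_1 g_1 ... a_n g_n is given by [n] and the sequences [g] and
   [a], of which only the entries of index at most [n] matter ([a 0] does not). *)
Definition alternating_word (n : nat) (g : nat -> term) (a : nat -> A) : seq term :=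
  g 0 :: flatten [seq [:: atom (a i); g i] | i <- iota 1 n].

Definition landscape (n : nat) (g : nat -> term) (a : nat -> A) :=
  (forall i, i <= n -> G' (g i)) /\
  (forall i, 0 < i <= n ->
     left_anchored (g i.-1) (a i) (g i) \/ right_anchored (g i.-1) (a i) (g i)).

Definition river (n : nat) (g : nat -> term) (i : nat) :=
  [/\ 0 < i < n, height (g i.-1) = (height (g i)).+1 &
      height (g i.+1) = (height (g i)).+1].

Definition nontrivial_mountain (n : nat) (g : nat -> term) (a : nat -> A) :=
  [/\ landscape n g a, 1 <= n, g 0 = A1, g n = A1 & forall i, ~ river n g i].

Definition g2e1 := tup gxx' A1 A1 Ax gxx'.
Definition g2e2 := tup gxx' Ax A1 A1 gxx'.

Fixpoint Go_ (i : nat) : set term :=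
  match i with
  | 0 => set0
  | 1 => [set gxx']
  | 2 => [set g2e1; g2e2]
  | 3 => [set g | exists p q a, [/\ g = tup p a gxx' a q,
                   [set p; q] = [set g2e1; g2e2] & a = A1 \/ a = Ax']]
  | j.+1 => [set g | [/\ Gd j.+1 g, Go_ j (gl g) & Go_ j (gr g)]]
  end.

Definition Go : set term := [set g | exists i, Go_ i g].

Definition Mo : set (seq term) :=
  [set u | exists n g a,
    [/\ u = alternating_word n.*2 g a, nontrivial_mountain n.*2 g a,
        forall i, i <= n.*2 -> (Go `|` [set atom A1]) (g i) &
        forall i, i < n.*2 -> height (g i) = 1%N -> a i.+1 = invA (a i)]].

Definition F1o : set F11 :=
  [set s | exists2 u : word letterG, Mo (map val (letters u)) & s = clsG u].

(* [he] and [hf] are the symbols e and f, identified with the triples (1, e, 1)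
   and (1, f, 1); [htri a b c] is the triple (a, b, c). *)
Inductive hterm :=
  | h1
  | he
  | hf
  | htri of hterm & hterm & hterm.

HB.instance Definition _ := gen_eqMixin hterm.
HB.instance Definition _ := gen_choiceMixin hterm.

(* On [h1] the three projections have junk values. *)
Definition hr (h : hterm) := if h is htri a _ _ then a else h1.
Definition hc (h : hterm) :=
  match h with h1 => h1 | he => he | hf => hf | htri _ b _ => b end.
Definition hl (h : hterm) := if h is htri _ _ c then c else h1.

Inductive H_ : nat -> hterm -> Prop :=
  | H_1 : H_ 0 h1
  | H_e : H_ 1 he
  | H_f : H_ 1 hf
  | H_tri i a b c :
      H_ i.+1 a -> H_ i b -> H_ i.+1 c ->
      c <> a ->
      ([set hl c; hr c] `&` [set hl a; hr a]) b ->
      H_ i.+2 (htri a b c).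

Definition H : set hterm := [set h | exists i, H_ i h].

Inductive rhoH : seq hterm -> seq hterm -> Prop :=
  | rhoH_1l h : H h -> rhoH [:: h1; h] [:: h]
  | rhoH_1r h : H h -> rhoH [:: h; h1] [:: h]
  | rhoH_idem h : H h -> rhoH [:: h; h] [:: h]
  | rhoH_l i h : 2 <= i -> H_ i h -> rhoH [:: hc h; hl h; h] [:: h]
  | rhoH_r i h : 2 <= i -> H_ i h -> rhoH [:: h; hr h; hc h] [:: h]
  | rhoH_sandwich i h : 2 <= i -> H_ i h ->
      rhoH [:: hr h; hc h; h; hc h; hl h] [:: hr h; hc h; hl h].

Notation letterH := (set_type H).

Definition relH (u v : word letterH) :=
  rhoH (map val (letters u)) (map val (letters v)).

Fact h1_H : h1 \in H.
Proof. by apply/mem_set; exists 0; constructor. Qed.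

Definition lone_H : letterH := exist _ h1 h1_H.

Definition one_H : quotient relH := class relH (mkword lone_H [::]).

Definition FI2 : set (quotient relH) := ~` [set one_H].

Lemma G5_neq_atom a g : G5 g -> (g == atom a) = false.
Proof.
move=> [i Gg]; apply/negbTE/eqP => ga; rewrite ga in Gg.
by inversion Gg as [? ? Gh|? ? Gh]; inversion Gh.
Qed.

Lemma G5_gr g : G5 g -> 2 <= height g -> G5 (gr g).
Proof.
move=> [i Gg]; inversion Gg as [j h Gh|j h Gh]; subst; inversion Gh; subst => //= _;
  by [exists i0; apply: G_e | exists i0.+2].
Qed.

Lemma rhoG_all1 u v : rhoG u v ->
  all (pred1 (atom A1)) u = all (pred1 (atom A1)) v.
Proof.
have [x1 x'1] : (atom Ax == A1) = false /\ (atom Ax' == A1) = false.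
  by split; apply/negbTE/eqP.
case=> /= [|||g Gg|g Gg|g Gg|g Gg g2|g Gg g2|g Gg g2];
  rewrite ?(x1, x'1, eqxx, andbT, andbb) //.
- by apply/negbTE/eqP.
- by rewrite (G5_neq_atom _ Gg) !andbF.
- by rewrite (G5_neq_atom _ Gg).
- by rewrite (G5_neq_atom _ (G5_gr Gg g2)).
Qed.

Lemma F11_mul1 : left_id one_F11 mul.
Proof.
apply: presented_mul1 => g; exact: rhoG_1l (set_mem (valP g)).
Qed.

Lemma F11_mulr1 : right_id one_F11 mul.
Proof.
apply: presented_mulr1 => g; exact: rhoG_1r (set_mem (valP g)).
Qed.

Lemma F1_subsemigroup : subsemigroup F1.
Proof.
apply: presented_nonidentity => [g|u v /rhoG_all1].
  exact: rhoG_1l (set_mem (valP g)).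
by rewrite !all_map.
Qed.

Lemma H_neq1 i h : 1 <= i -> H_ i h -> (h == h1) = false.
Proof. by move=> i1 Hh; apply/negbTE/eqP => hh; case: Hh hh i1. Qed.

Lemma rhoH_all1 u v : rhoH u v -> all (pred1 h1) u = all (pred1 h1) v.
Proof.
case=> /= [h Hh|h Hh|h Hh|i h i2 Hh|i h i2 Hh|i h i2 Hh];
  rewrite ?(eqxx, andbT, andbb) // ?(H_neq1 (ltnW i2) Hh) ?andbF //.
case: i h / Hh i2 => //= i a b c Ha _ _ _ _ _.
by rewrite (H_neq1 _ Ha).
Qed.

Lemma one_H_mul1 : left_id one_H mul.
Proof.
apply: presented_mul1 => h; exact: rhoH_1l (set_mem (valP h)).
Qed.

Lemma one_H_mulr1 : right_id one_H mul.
Proof.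
apply: presented_mulr1 => h; exact: rhoH_1r (set_mem (valP h)).
Qed.

Lemma FI2_subsemigroup : subsemigroup FI2.
Proof.
apply: presented_nonidentity => [h|u v /rhoH_all1].
  exact: rhoH_1l (set_mem (valP h)).
by rewrite !all_map.
Qed.

(* Main.v *)
Require Import Defs.
From HB Require Import structures.
From mathcomp Require Import all_boot zify.
From mathcomp Require Import boolp classical_sets functions.
Local Open Scope classical_set_scope.

(** Everything rests on a morphism [Psi] from [FI2] with its identity to [F11].
    It sends [he] to [xx'] and [hf] to [x'x], and a letter [h] of larger height
    to a conjugate, by a label 1 or [x], of a letter [Phi h] of [Go]; the labels
    of the five-tuple [Phi h] are the ones that turn the defining relations of
    [h] into those of [Phi h].

    In [FI2] a letter equals the product of the walk that climbs from 1 to it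
    and comes back. In a walk, a valley [p c p] can be contracted to [p], and a
    valley [p c q] with [p <> q] can be filled in to [p (p,c,q) q]. The process
    ends with a walk without rivers, so every element is the class of a
    mountain ([nf_stack], [mountain_of]). This has two cheap consequences. The
    mountains of [FI2] and those of [Mo] correspond under [Phi], so that [F1o]
    is the image under [Psi] of [FI2] ([F1oE]); hence it is a subsemigroup. And
    the reversal of a mountain is an inverse of it ([stack_regular]), whence
    regularity.

    The filling process is deterministic and compatible with the defining
    relations ([peq_walk_of]), hence the mountain of an element is unique.
    Comparing mountains shows that a triple is the only element satisfying its
    own defining relations ([rigid]): they prescribe how the mountain of a
    solution begins and ends, and bound its height, which leaves one
    possibility for its peak.

    Rigidity gives weak generation: if a regular subsemigroup contains [r], [c]
    and [l], and [t] is an inverse of [r c l] in it, then [c l t r c] satisfies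
    the relations of [(r,c,l)], so it is that letter
    ([FI2_weakly_generated]).

    Rigidity also gives the injectivity of [Psi]. A regular monoid with
    mutually inverse elements [x] and [x'] receives a morphism from [F11]: one
    chooses recursively, for each letter, a solution of its relations
    ([F11_universal]). Take the semidirect product of [FI2], with its identity,
    and the group of order two generated by the exchange [s] of [e] and [f],
    where [x = es] and [x' = fs] satisfy [xx' = e] and [x'x = f]. Whatever the
    choices, the composite with [Psi] sends every letter to an element that
    satisfies its relations, so by rigidity it is the canonical embedding
    ([Psi_retraction]). *)

Set Implicit Arguments.
Unset Strict Implicit.
Unset Printing Implicit Defensive.

(** * Heights and neighbours in the alphabet of FI2 *)

Fixpoint hheight (h : hterm) : nat :=
  match h with h1 => 0 | htri a _ _ => (hheight a).+1 | _ => 1 end.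

(** [below p q] says that [p] is [hl q] or [hr q], where [q] is not the letter
    [h1] of height 0: on [h1] these projections are junk. *)
Definition below (p q : hterm) := [/\ H q, 0 < hheight q & p = hl q \/ p = hr q].

Lemma hheight_H_ i h : H_ i h -> hheight h = i.
Proof. by elim=> //= j a b c _ -> . Qed.

Lemma H_hheight h : H h -> H_ (hheight h) h.
Proof. by move=> [i Hh]; rewrite (hheight_H_ Hh). Qed.

Lemma H1 : H h1. Proof. by exists 0; constructor. Qed.
Lemma He : H he. Proof. by exists 1; constructor. Qed.
Lemma Hf : H hf. Proof. by exists 1; constructor. Qed.

Lemma below_e : below h1 he. Proof. by split; [exact: He| |left]. Qed.
Lemma below_f : below h1 hf. Proof. by split; [exact: Hf| |left]. Qed.

Lemma hheight_eq0 h : H h -> hheight h = 0 -> h = h1.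
Proof. by case: h. Qed.

Lemma H_triP a b c : H (htri a b c) ->
  [/\ below a (htri a b c), below c (htri a b c), below b a, below b c & c <> a].
Proof.
move=> Hh; case: (Hh) => i Hi.
inversion Hi as [| | | j a' b' c' Ha Hb Hc ca [bc ba]]; subst.
have [ea ec] := (hheight_H_ Ha, hheight_H_ Hc).
split=> //; split=> //=; try by [left|right].
- by exists j.+1.
- by rewrite ea.
- by exists j.+1.
- by rewrite ec.
Qed.

Lemma below_H p q : below p q -> H p.
Proof.
case=> -[i Hq]; case: Hq => //=.
- by move=> _ [] ->; exact: H1.
- by move=> _ [] ->; exact: H1.
- by move=> j a b c Ha _ Hc _ _ _ [] ->; exists j.+1.
Qed.

Lemma hheight_below p q : below p q -> hheight q = (hheight p).+1.
Proof.
case=> -[i Hq]; case: Hq => //=.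
- by move=> _ [] ->.
- by move=> _ [] ->.
- by move=> j a b c /hheight_H_ ea _ /hheight_H_ ec _ _ _ [] ->; rewrite ea ?ec.
Qed.

(** The letter that fills in a river [p c q]. *)
Lemma H_valley p c q : below c p -> below c q -> p <> q ->
  [/\ H (htri p c q), below p (htri p c q) & below q (htri p c q)].
Proof.
move=> bp bq pq.
have Hpcq : H (htri p c q).
  exists (hheight c).+2; constructor.
  - by rewrite -(hheight_below bp); case: (bp) => /H_hheight.
  - exact: H_hheight (below_H bp).
  - by rewrite -(hheight_below bq); case: (bq) => /H_hheight.
  - by move/esym.
  - by case: bp bq => _ _ bp [_ _ bq]; split.
by split=> //; split=> //; [right|left].
Qed.

(** * Filling in the rivers of a walk *)

(** A stack is a walk in reverse order, its last letter at the head. Pushing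
    [y] above a letter [c] reached from above creates a river [p c y]; it is
    contracted if [p = y], and else [c] makes way for [htri p c y], whose
    insertion after [p] may create a new river further down the stack. *)
Fixpoint push (st : seq hterm) (y : hterm) : seq hterm :=
  match st with
  | c :: ((p :: _) as st') =>
      if (hheight c < hheight y) && (hheight c < hheight p) then
        if p == y then st' else y :: push st' (htri p c y)
      else y :: st
  | _ => y :: st
  end.

Arguments push : simpl never.

Lemma pushE c p st y : push [:: c, p & st] y =
  if (hheight c < hheight y) && (hheight c < hheight p) then
    if p == y then p :: st else y :: push (p :: st) (htri p c y)
  else [:: y, c, p & st].
Proof. by []. Qed.

Definition run (st w : seq hterm) := foldl push st w.

(** The way from [h1] up to [h], without its starting point: above the centre
    [b] of [htri a b c] it goes through the left neighbour [c]. *)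
Definition up := fix up (h : hterm) : seq hterm :=
  match h with
  | h1 => [::]
  | htri _ b c => up b ++ [:: c; h]
  | _ => [:: h]
  end.

(** The way back to [h1], without [h]: it takes the other neighbour, so
    that [up] and [down] are the two sides of the products in the relations
    [rhoH_l] and [rhoH_r]. *)
Definition down := fix down (h : hterm) : seq hterm :=
  match h with
  | h1 => [::]
  | htri a b _ => [:: a, b & down b]
  | _ => [:: h1]
  end.

Definition peak_path (h : hterm) := up h ++ down h.

Definition walk_of (u : seq hterm) := flatten (map peak_path u).

Lemma walk_of_cat u v : walk_of (u ++ v) = walk_of u ++ walk_of v.
Proof. by rewrite /walk_of map_cat flatten_cat. Qed.

Lemma last_up h : last h1 (up h) = h.
Proof. by case: h => //= a b c; rewrite last_cat. Qed.

Lemma last_down h : last h (down h) = h1.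
Proof. by elim: h => //= a _ b -> c _. Qed.

Lemma last_peak h : last h1 (peak_path h) = h1.
Proof. by rewrite last_cat last_up last_down. Qed.

Lemma last_walk_of u : last h1 (walk_of u) = h1.
Proof. by elim: u => //= h u IHu; rewrite /walk_of /= last_cat last_peak. Qed.

Lemma push_cons st y : exists st', push st y = y :: st'.
Proof.
case: st => [|c [|p st]]; [by exists [::]|by exists [:: c]|].
rewrite pushE; case: ifP => _; last by exists [:: c, p & st].
by case: eqP => [->|_]; [exists st|exists (push (p :: st) (htri p c y))].
Qed.

Lemma run_cat st u v : run st (u ++ v) = run (run st u) v.
Proof. exact: foldl_cat. Qed.

Lemma run_cons x st w : exists st', run (x :: st) w = last x w :: st'.
Proof.
elim: w x st => [|y w IHw] x st /=; first by exists st.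
have [st' ->] := push_cons (x :: st) y; exact: IHw.
Qed.

(** Two walks starting at [x] are equivalent if filling in rivers after any
    common beginning gives the same result. As [push] rewrites from left to
    right, equivalence is a congruence for the concatenation of walks, and
    filling in one river does not change the equivalence class, with no
    confluence argument needed. *)
Definition peq (x : hterm) (w w' : seq hterm) :=
  forall st, run (x :: st) w = run (x :: st) w'.

Lemma peq_sym x w w' : peq x w w' -> peq x w' w.
Proof. by move=> e st; rewrite e. Qed.

Lemma peq_trans x v u w : peq x u v -> peq x v w -> peq x u w.
Proof. by move=> e e' st; rewrite e e'. Qed.

Lemma peq_catr x w w' v : peq x w w' -> peq x (w ++ v) (w' ++ v).
Proof. by move=> e st; rewrite !run_cat e. Qed.

Lemma peq_catl x u w w' : peq (last x u) w w' -> peq x (u ++ w) (u ++ w').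
Proof. by move=> e st; rewrite !run_cat; have [st' ->] := run_cons x st u. Qed.

Lemma peq_cons x y w w' : peq y w w' -> peq x (y :: w) (y :: w').
Proof. exact: (@peq_catl x [:: y]). Qed.

Lemma push_down x st y : hheight y < hheight x -> push (x :: st) y = y :: x :: st.
Proof. by case: st => // p st yx; rewrite pushE ltnNge (ltnW yx). Qed.

Lemma peq_back c p w : below c p -> peq p [:: c, p & w] w.
Proof.
move=> /hheight_below e; apply: (@peq_catr _ [:: c; p] [::]) => st.
by rewrite /run /= push_down ?e // pushE e ltnSn eqxx.
Qed.

(** Pushing [c] and then [q] onto [p] is by definition pushing [htri p c q]
    onto [p] and then [q]. *)
Lemma peq_turn p c q w : below c p -> below c q -> p <> q ->
  peq p [:: c, q & w] [:: htri p c q, q & w].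
Proof.
move=> bp bq pq; apply: (@peq_catr _ [:: c; q] [:: htri p c q; q]) => st.
rewrite /run.
have [[[_ _ bg'] ep] eq] := (H_valley bp bq pq, hheight_below bp, hheight_below bq).
have [st' E] := push_cons (p :: st) (htri p c q).
rewrite /= push_down ?ep // pushE ep eq ltnSn; case: eqP => // _.
by rewrite E push_down // (hheight_below bg').
Qed.

(** Below [h = htri a b c] the detour returns to [b] by induction, which
    leaves [h a b c h]; filling in [a b c] to [a h c] makes it collapse. *)
Lemma peq_down_up h w : H h -> peq h (down h ++ up h ++ w) w.
Proof.
elim: h w => [|||a IHa b IHb c IHc] // w Hh.
- exact: peq_back below_e.
- exact: peq_back below_f.
have [bah bch bba bbc ca] := H_triP Hh.
have Hb := below_H bba.
rewrite /= -/(up b) -/(down b) -catA.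
apply: (@peq_trans _ [:: a, b, c, htri a b c & w]).
  by do 2!apply: peq_cons; exact: IHb.
have ac : a <> c by move/esym.
apply: (@peq_trans _ [:: a, htri a b c, c, htri a b c & w]).
  by apply: peq_cons; apply: peq_turn.
by apply: peq_trans (peq_back _ bah) _; apply: peq_back.
Qed.

(** Going from a letter to a neighbour through [h1] amounts to taking one
    step. The induction is on the upper letter [h]; the lower letter [c] takes
    its place with respect to the centre [b] of [h], which is below [c]. *)
Lemma peq_climb c h : below c h ->
  (forall w, peq h (down h ++ up c ++ w) (c :: w)) /\
  (forall w, peq c (down c ++ up h ++ w) (h :: w)).
Proof.
elim: h c => [|||a IHa b IHb l IHl] c bc //.
- by case: bc.
- by case: bc => _ _ [] ->.
- by case: bc => _ _ [] ->.
case: (bc) => Hh _ /= cal; have [bah blh bba bbl la] := H_triP Hh.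
have letA : a <> l by move/esym.
have [D1 D2] : (forall w, peq b (down b ++ up c ++ w) (c :: w)) /\
    (forall w, peq c (down c ++ up b ++ w) (b :: w)).
  by case: cal => ->; [case: (IHl b bbl)|case: (IHa b bba)].
rewrite -/(down b) -/(up b); split=> w.
- apply: (@peq_trans _ [:: a, b, c & w]).
    by do 2!apply: peq_cons; exact: D1.
  case: cal => ->; last exact/peq_cons/peq_back.
  apply: (@peq_trans _ [:: a, htri a b l, l & w]).
    exact/peq_cons/peq_turn.
  exact: peq_back.
- rewrite -catA; apply: (@peq_trans _ [:: b, l, htri a b l & w]).
    exact: D2.
  case: cal => ->; first exact: peq_back.
  apply: (@peq_trans _ [:: htri a b l, l, htri a b l & w]).
    exact: peq_turn.
  exact/peq_cons/peq_back.
Qed.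

Lemma peq_step x y w : below x y \/ below y x ->
  peq x (down x ++ up y ++ w) (y :: w).
Proof. by case=> b; have [D U] := peq_climb b; [exact: U|exact: D]. Qed.

Lemma below_l r c l : H (htri r c l) -> below l (htri r c l).
Proof. by case/H_triP. Qed.

Lemma below_r r c l : H (htri r c l) -> below r (htri r c l).
Proof. by case/H_triP. Qed.

Lemma walk_of_cons h u : walk_of (h :: u) = up h ++ down h ++ walk_of u.
Proof. by rewrite /walk_of /= catA. Qed.

Lemma peq_up x w w' : peq x w w' -> peq h1 (up x ++ w) (up x ++ w').
Proof. by move=> e; apply: peq_catl; rewrite last_up. Qed.

(** * The defining relations of FI2 preserve the normal form *)

Lemma peq_idem h u : H h -> peq h1 (walk_of [:: h, h & u]) (walk_of (h :: u)).
Proof. by move=> Hh; rewrite !walk_of_cons; apply: peq_up; exact: peq_down_up. Qed.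

Lemma peq_l r c l u : H (htri r c l) ->
  peq h1 (walk_of [:: c, l, htri r c l & u]) (walk_of (htri r c l :: u)).
Proof.
move=> Hh; have [_ blh _ bcl _] := H_triP Hh.
rewrite !walk_of_cons [in X in peq _ _ X]/= -/(up c) -!catA /=.
apply: peq_up; apply: peq_trans (peq_step _ (or_introl bcl)) _.
apply: peq_cons.
apply: peq_trans (peq_step _ (or_intror bcl)) _.
exact: peq_back.
Qed.

Lemma peq_r r c l u : H (htri r c l) ->
  peq h1 (walk_of [:: htri r c l, r, c & u]) (walk_of (htri r c l :: u)).
Proof.
move=> Hh; have [brh _ bcr _ _] := H_triP Hh.
rewrite !walk_of_cons; apply: peq_up.
rewrite /= -/(down c); apply: peq_cons.
set X := walk_of u; have Hc := below_H bcr.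
apply: (@peq_trans _ (c :: r :: down r ++ up c ++ down c ++ X)).
  apply: peq_cons; apply: (peq_step _ (or_introl bcr)).
rewrite -/(down c) -/(up c).
apply: (@peq_trans _ [:: c, r, c & down c ++ X]).
  do 2!apply: peq_cons; exact: (peq_step _ (or_intror bcr)).
exact: peq_back.
Qed.

(** The walk of a product [r c l] is the walk through the river [r c l]. *)
Lemma peq_rcl r c l u : H (htri r c l) ->
  peq h1 (walk_of [:: r, c, l & u]) (up r ++ [:: c, l & down l ++ walk_of u]).
Proof.
move=> Hh; have [_ _ bcr bcl _] := H_triP Hh.
rewrite !walk_of_cons; apply: peq_up.
apply: peq_trans (peq_step _ (or_intror bcr)) _.
by apply: peq_cons; exact: (peq_step _ (or_introl bcl)).
Qed.

Lemma peq_sandwich r c l u : H (htri r c l) ->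
  peq h1 (walk_of [:: r, c, htri r c l, c, l & u]) (walk_of [:: r, c, l & u]).
Proof.
move=> Hh; have [brh blh bcr bcl lr] := H_triP Hh.
have rl : r <> l by move/esym.
apply: peq_trans (peq_sym (peq_rcl _ Hh)).
rewrite !walk_of_cons; apply: peq_up; set X := walk_of u.
apply: peq_trans (peq_step _ (or_intror bcr)) _; rewrite /= -/(up c) -/(down c) -!catA /=.
apply: (@peq_trans _
  [:: c, l, htri r c l, r, c & down c ++ up c ++ down c ++ up l ++ down l ++ X]).
  by apply: peq_cons; apply: peq_down_up (below_H bcr).
apply: (@peq_trans _ [:: c, l, htri r c l, r, c, l & down l ++ X]).
  do 5!apply: peq_cons; apply: peq_trans (peq_down_up _ (below_H bcr)) _.
  exact: (peq_step _ (or_introl bcl)).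
apply: (@peq_trans _ [:: htri r c l, l & down l ++ X]); last exact/peq_sym/peq_turn.
apply: peq_trans (peq_turn _ bcr bcl rl) _; apply: peq_cons.
apply: peq_trans (peq_back _ blh) _.
apply: (@peq_trans _ [:: r, htri r c l, l & down l ++ X]).
  by apply: peq_cons; exact: peq_turn.
exact: peq_back.
Qed.

Lemma H_ge2 i h : 2 <= i -> H_ i h -> exists r c l, h = htri r c l /\ H (htri r c l).
Proof.
move=> + Hh; case: (Hh) => // j r c l *.
by exists r, c, l; split=> //; exists j.+2; constructor.
Qed.

Lemma peq_rhoH u v w : rhoH u v -> peq h1 (walk_of (u ++ w)) (walk_of (v ++ w)).
Proof.
case=> [h Hh|h Hh|h Hh|i h i2 /(H_ge2 i2)[r [c [l [-> Hh]]]]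
  |i h i2 /(H_ge2 i2)[r [c [l [-> Hh]]]]|i h i2 /(H_ge2 i2)[r [c [l [-> Hh]]]]] //=.
- exact: peq_idem.
- exact: peq_l.
- exact: peq_r.
- exact: peq_sandwich.
Qed.

(** * The two presented monoids *)

Local Open Scope group_scope.

Notation prodw f s := (\big[*%g/1%g]_(x <- s) f x).

Definition letters_in (T : Type) (X : set T) (s : seq T) : Prop :=
  foldr (fun x P => X x /\ P) True s.

Section WordsOverSet.
Variables (T : choiceType) (X : set T).

(** Words over a subset are handled as sequences of elements of the ambient
    type, to which the relations [rhoG] and [rhoH] apply directly. *)
Lemma word_of (s : seq T) : s != [::] -> letters_in X s ->
  exists u : word (set_type X), map val (letters u) = s.
Proof.
move=> s0 Xs.
have [t Et] : exists t : seq (set_type X), map val t = s.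
  elim: s {s0} Xs => [|x s IHs] /=; first by exists [::].
  case=> /mem_set Xx /IHs[t Et].
  by exists (exist _ x Xx :: t); rewrite /= Et.
have t0 : t != [::] by apply: contra_neq s0 => t0; rewrite -Et t0.
by exists (Word t0).
Qed.

End WordsOverSet.

Section HomOf.
Variables (L : choiceType) (R : word L -> word L -> Prop).
Variables (M : monoidType) (f : L -> M).
Hypothesis Rf : forall u v, R u v -> prodw f (letters u) = prodw f (letters v).

Definition hom_of (c : quotient R) : M := prodw f (letters (repr c)).

Lemma hom_of_class u : hom_of (class R u) = prodw f (letters u).
Proof.
have /classP/(_ (fun v w => prodw f (letters v) = prodw f (letters w))) :
  class R (repr (class R u)) = class R u by rewrite class_repr.
apply=> [|v w /Rf//]; split=> // [a b c -> //|a b c ab].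
by rewrite !letters_mul !big_cat /= ab.
Qed.

Lemma hom_of_mul c d : hom_of (c * d) = hom_of c * hom_of d.
Proof.
rewrite -[c]class_repr -[d]class_repr -class_mul !hom_of_class.
by rewrite letters_mul big_cat.
Qed.

End HomOf.

(** [FI2] with its identity, and below [F11], as monoids. *)
Definition FI2m : Type := quotient relH.
HB.instance Definition _ := Semigroup.copy FI2m (quotient relH).
HB.instance Definition _ :=
  Semigroup_isMonoid.Build FI2m one_H_mul1 one_H_mulr1.

Definition F11m : Type := F11.
HB.instance Definition _ := Semigroup.copy F11m F11.
HB.instance Definition _ := Semigroup_isMonoid.Build F11m F11_mul1 F11_mulr1.

(** The class of a letter. Outside the alphabet, [insubd] gives the identity,
    so that products over arbitrary sequences make sense. *)
Definition letH (h : hterm) : FI2m := class relH (mkword (insubd lone_H h) [::]).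

Definition letG (g : term) : F11m :=
  class relG (mkword (insubd (latom A1) g) [::]).

Lemma class_letH (u : word letterH) :
  class relH u = prodw letH (map val (letters u)) :> FI2m.
Proof.
rewrite big_map; case: u => -[//|a s] i; rewrite WordE /= {i}.
elim: s a => [|b s IHs] a; rewrite big_cons.
  by rewrite big_nil mulg1 /letH valKd.
by rewrite -IHs /letH valKd -class_mul mkword_mul.
Qed.

Lemma class_letG (u : word letterG) :
  class relG u = prodw letG (map val (letters u)) :> F11m.
Proof.
rewrite big_map; case: u => -[//|a s] i; rewrite WordE /= {i}.
elim: s a => [|b s IHs] a; rewrite big_cons.
  by rewrite big_nil mulg1 /letG valKd.
by rewrite -IHs /letG valKd -class_mul mkword_mul.
Qed.

Lemma letH_rel u v : rhoH u v -> u != [::] -> v != [::] ->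
  letters_in H u -> letters_in H v -> prodw letH u = prodw letH v.
Proof.
move=> uv u0 v0 /(word_of u0)[u' Eu] /(word_of v0)[v' Ev].
rewrite -Eu -Ev -!class_letH; apply/classP; apply: gen_congruence_incl.
by rewrite /relH Eu Ev.
Qed.

Lemma letG_rel u v : rhoG u v -> u != [::] -> v != [::] ->
  letters_in G u -> letters_in G v -> prodw letG u = prodw letG v.
Proof.
move=> uv u0 v0 /(word_of u0)[u' Eu] /(word_of v0)[v' Ev].
rewrite -Eu -Ev -!class_letG; apply/classP; apply: gen_congruence_incl.
by rewrite /relG Eu Ev.
Qed.

Lemma letG_1 : letG A1 = 1.
Proof.
rewrite /letG; congr (class _ (mkword _ _)); apply: val_inj.
by rewrite val_insubd atom_G.
Qed.

Lemma letH_1 : letH h1 = 1.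
Proof.
rewrite /letH; congr (class _ (mkword _ _)); apply: val_inj.
by rewrite val_insubd h1_H.
Qed.

Lemma letH_idem h : H h -> letH h * letH h = letH h.
Proof.
move=> Hh; have := letH_rel (rhoH_idem Hh) isT isT.
rewrite !(big_cons, big_nil) !mulg1; apply; by do !split.
Qed.

Section Triple.
Variables (r c l : hterm).
Hypothesis Hh : H (htri r c l).
Let h := htri r c l.

Let Hr : H r. Proof. by have [/below_H] := H_triP Hh. Qed.
Let Hc : H c. Proof. by have [_ _ /below_H] := H_triP Hh. Qed.
Let Hl : H l. Proof. by have [_ /below_H] := H_triP Hh. Qed.
Let Hn : H_ (hheight h) h. Proof. exact: H_hheight. Qed.
Let n2 : 2 <= hheight h. Proof. by have [_ _ /hheight_below /= ->] := H_triP Hh. Qed.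

Lemma letH_l : letH c * letH l * letH h = letH h.
Proof.
have := letH_rel (rhoH_l n2 Hn) isT isT.
rewrite !(big_cons, big_nil) !mulg1 !mulgA; apply; by do !split.
Qed.

Lemma letH_r : letH h * letH r * letH c = letH h.
Proof.
have := letH_rel (rhoH_r n2 Hn) isT isT.
rewrite !(big_cons, big_nil) !mulg1 !mulgA; apply; by do !split.
Qed.

Lemma letH_cl : letH c * letH h = letH h.
Proof. by rewrite -[in LHS]letH_l !mulgA letH_idem // letH_l. Qed.

Lemma letH_cr : letH h * letH c = letH h.
Proof. by rewrite -[in LHS]letH_r -!mulgA letH_idem // !mulgA letH_r. Qed.

Lemma letH_sandwich :
  letH r * letH h * letH l = letH r * letH c * letH l.
Proof.
have := letH_rel (rhoH_sandwich n2 Hn) isT isT.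
rewrite !(big_cons, big_nil) !mulg1 !mulgA -(mulgA _ (letH c) (letH h)) letH_cl.
rewrite -(mulgA _ (letH h) (letH c)) letH_cr; apply; by do !split.
Qed.

End Triple.

(** With [hc p] absorbed by [p], both defining relations of a triple say that
    stepping down and up again changes nothing. *)
Lemma letH_back c p : below c p -> letH p * letH c * letH p = letH p.
Proof.
case: p => [|||r b l] bc.
- by case: bc.
- by case: bc => _ _ [] -> /=; rewrite letH_1 mulg1 letH_idem //; exact: He.
- by case: bc => _ _ [] -> /=; rewrite letH_1 mulg1 letH_idem //; exact: Hf.
case: bc => Hp _ [] -> /=.
- by rewrite -{1}(letH_cr Hp) -2!mulgA (mulgA (letH b)) letH_l // letH_idem.
- by rewrite -{2}(letH_cl Hp) !mulgA letH_r // letH_idem.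
Qed.

(** Filling in a river is the sandwich relation of the new letter. *)
Lemma letH_turn p c q : below c p -> below c q -> p <> q ->
  letH p * letH c * letH q = letH p * letH (htri p c q) * letH q.
Proof. by move=> bp bq pq; have [/letH_sandwich] := H_valley bp bq pq. Qed.

Lemma prod_up h : H h -> prodw letH (up h) = letH h.
Proof.
elim: h => [||| r _ b IHb l _] Hh; try by rewrite ?big_cons big_nil ?mulg1 ?letH_1.
have [_ _ bb _ _] := H_triP Hh.
rewrite /= -/(up b) big_cat /= (IHb (below_H bb)) !big_cons big_nil mulg1.
by rewrite mulgA letH_l.
Qed.

Lemma prod_down h : H h -> letH h * prodw letH (down h) = letH h.
Proof.
elim: h => [||| r _ b IHb l _] Hh;
  try by rewrite ?big_cons big_nil ?letH_1 !mulg1.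
have [_ _ bb _ _] := H_triP Hh.
rewrite /= -/(down b) !big_cons (IHb (below_H bb)).
by rewrite mulgA letH_r.
Qed.

Lemma prod_peak h : H h -> prodw letH (peak_path h) = letH h.
Proof. by move=> Hh; rewrite big_cat /= prod_up // prod_down. Qed.

Lemma prod_walk_of u : letters_in H u -> prodw letH (walk_of u) = prodw letH u.
Proof.
elim: u => //= h u IHu [Hh /IHu e].
by rewrite /walk_of /= big_cat /= -/(walk_of u) e big_cons prod_peak.
Qed.

(** * Mountains represent all elements of FI2 *)

Definition adj (p q : hterm) : bool := `[< below p q \/ below q p >].

Lemma adjP p q : reflect (below p q \/ below q p) (adj p q).
Proof. exact: asboolP. Qed.

Lemma adj_sym p q : adj p q = adj q p.
Proof. by apply/adjP/adjP; case; auto. Qed.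

Lemma adj_below p q : adj p q -> hheight p < hheight q -> below p q.
Proof. by move=> /adjP[//|/hheight_below ->]; rewrite ltnNge ltnW. Qed.

Lemma adj_hheight p q : adj p q -> hheight q = (hheight p).+1 \/ hheight p = (hheight q).+1.
Proof. by move=> /adjP[] /hheight_below; auto. Qed.

Lemma adj_H p q : adj p q -> H p /\ H q.
Proof. by move=> /adjP[] b; split; by [exact: below_H b|case: b]. Qed.

Fixpoint riverless (t : seq hterm) : bool :=
  match t with
  | x :: ((y :: (z :: _)) as t') =>
      ~~ ((hheight y < hheight x) && (hheight y < hheight z)) && riverless t'
  | _ => true
  end.

Lemma riverlessE x y z t : riverless [:: x, y, z & t] =
  ~~ ((hheight y < hheight x) && (hheight y < hheight z)) && riverless [:: y, z & t].
Proof. by []. Qed.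
Arguments riverless : simpl never.

Lemma riverless_cons x t : riverless (x :: t) -> riverless t.
Proof. by case: t => [|y [|z t]] //; rewrite riverlessE => /andP[]. Qed.

Definition stack (t : seq hterm) := sorted adj t && riverless t.

Lemma stack_cons x t : stack (x :: t) -> stack t.
Proof.
case/andP=> /= s /riverless_cons r; rewrite /stack r andbT.
exact: path_sorted s.
Qed.

Lemma stack_no_river y c p st : stack [:: c, p & st] -> adj c y ->
  ~~ ((hheight c < hheight y) && (hheight c < hheight p)) -> stack [:: y, c, p & st].
Proof.
by case/andP=> /= s r a nr; rewrite /stack riverlessE nr r /= adj_sym a s.
Qed.

(** No river survives: [htri p c y] is put above [y], so the only possible new
    river is at [p], and it is treated by the recursive call. *)
Lemma stack_push x st y : stack (x :: st) -> adj x y -> stack (push (x :: st) y).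
Proof.
elim: st x y => [|p st IHst] c y s a.
  by rewrite /push /stack /= adj_sym a.
rewrite pushE; case: ifP => [/andP[cy cp]|/negbT nr]; last exact: stack_no_river.
have s' := stack_cons s.
case: eqP => [_|py] //.
have bp : below c p by apply: adj_below => //; case/andP: s => /= /andP[].
have by_ := adj_below a cy.
have [_ bpg bqg] := H_valley bp by_ py.
have := IHst p (htri p c y) s'; have [st' ->] := push_cons (p :: st) (htri p c y).
move=> IH; have sg : stack (htri p c y :: st') by apply: IH; apply/adjP; left.
case: st' sg {IH} => [|q st'] sg.
  by apply/andP; split=> //=; rewrite andbT; apply/adjP; left.
apply: stack_no_river => //; first by apply/adjP; right.
by rewrite (hheight_below bqg) ltnNge leqnSn.
Qed.

Lemma last_push x st y : last h1 (push (x :: st) y) = last x st.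
Proof.
elim: st x y => [|p st IHst] c y //; rewrite pushE; case: ifP => // _.
case: eqP => // _ /=; have := IHst p (htri p c y).
by have [st' ->] := push_cons (p :: st) (htri p c y).
Qed.

Lemma prod_push x st y : stack (x :: st) -> adj x y ->
  prodw letH (rev (push (x :: st) y)) = prodw letH (rev (x :: st)) * letH y.
Proof.
have pc z s : prodw letH (rev (z :: s)) = prodw letH (rev s) * letH z.
  by rewrite rev_cons -cats1 big_cat /= big_cons big_nil mulg1.
elim: st x y => [|p st IHst] c y s a; first by rewrite /push pc.
rewrite pushE; case: ifP => [/andP[cy cp]|_]; last by rewrite pc.
have s' := stack_cons s.
have bp : below c p by apply: adj_below => //; case/andP: s => /= /andP[].
have by_ := adj_below a cy.
case: eqP => [<-|py].
  by rewrite !pc -!mulgA (mulgA (letH p)) letH_back.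
have [_ bpg bqg] := H_valley bp by_ py.
rewrite pc IHst //; last by apply/adjP; left.
by rewrite !pc -!mulgA 2!(mulgA (letH p)) (letH_turn bp by_ py).
Qed.

Lemma stack_run x st w : stack (x :: st) -> path adj x w ->
  [/\ stack (run (x :: st) w), last h1 (run (x :: st) w) = last x st &
   prodw letH (rev (run (x :: st) w)) =
   prodw letH (rev (x :: st)) * prodw letH w].
Proof.
elim: w x st => [|y w IHw] x st s /=; first by rewrite big_nil mulg1.
case/andP=> a pw.
have := (stack_push s a, last_push x st y, prod_push s a).
have [st' ->] := push_cons (x :: st) y; rewrite [last h1 _]/= => -[[s' l'] e'].
have [? -> ->] := IHw _ _ s' pw.
by rewrite big_cons mulgA e'.
Qed.

Lemma path_up h : H h -> path adj h1 (up h).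
Proof.
elim: h => [||| r _ b IHb l _] // Hh; try by rewrite /= andbT; apply/adjP; left.
- by rewrite /= andbT; apply/adjP; left; exact: below_e.
- by rewrite /= andbT; apply/adjP; left; exact: below_f.
have [_ bl bb bbl _] := H_triP Hh.
rewrite /= -/(up b) cat_path last_up IHb /= ?andbT; last exact: below_H bb.
by apply/andP; split; apply/adjP; left.
Qed.

Lemma path_down h : H h -> path adj h (down h).
Proof.
elim: h => [||| r _ b IHb l _] // Hh.
- by rewrite /= andbT; apply/adjP; right; exact: below_e.
- by rewrite /= andbT; apply/adjP; right; exact: below_f.
have [br _ bb _ _] := H_triP Hh.
rewrite /= -/(down b) IHb; last exact: below_H bb.
by rewrite andbT; apply/andP; split; apply/adjP; right.
Qed.

Lemma path_peak h : H h -> path adj h1 (peak_path h).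
Proof. by move=> Hh; rewrite cat_path path_up // last_up path_down. Qed.

Lemma path_walk_of u : letters_in H u -> path adj h1 (walk_of u).
Proof.
elim: u => //= h u IHu [Hh Hu]; rewrite /walk_of /= -/(walk_of u) cat_path path_peak //=.
by rewrite last_peak IHu.
Qed.

(** The mountain of a product of letters, in reverse order. *)
Definition nf (u : seq hterm) := run [:: h1] (walk_of u).

Lemma letters_in_val (T : choiceType) (X : set T) (s : seq (set_type X)) :
  letters_in X (map val s).
Proof. by elim: s => //= x s IHs; split=> //; exact: set_mem (valP x). Qed.

Lemma letters_in_prod (s : FI2m) : exists2 u, letters_in H u & s = prodw letH u.
Proof.
exists (map val (letters (repr s))); first exact: letters_in_val.
by rewrite -class_letH class_repr.
Qed.

Lemma letters_in_cat (T : Type) (X : set T) s t :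
  letters_in X s -> letters_in X t -> letters_in X (s ++ t).
Proof. by move=> + Xt; elim: s => //= x s IHs [Xx /IHs]. Qed.

(** The right-hand side is a congruence in [u] and [v], because all the walks
    [walk_of u] begin and end at [h1], and it contains the defining
    relations. *)
Lemma peq_walk_of u v : letters_in H u -> letters_in H v ->
  prodw letH u = prodw letH v -> peq h1 (walk_of u) (walk_of v).
Proof.
have wlog_ne u1 v1 : u1 != [::] -> v1 != [::] -> letters_in H u1 -> letters_in H v1 ->
  prodw letH u1 = prodw letH v1 -> peq h1 (walk_of u1) (walk_of v1).
  move=> u0 v0 /(word_of u0)[{u0}u <-] /(word_of v0)[{v0}v <-].
  rewrite -!class_letH.
  move/classP/(_ (fun u v => peq h1 (walk_of (map val (letters u)))
      (walk_of (map val (letters v))))); apply; last first.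
    by move=> a b ab; have := peq_rhoH [::] ab; rewrite !cats0.
  split=> [//|a b /peq_sym //|a b c /peq_trans|a b c ab]; first exact.
  rewrite !letters_mul !map_cat !walk_of_cat; split.
    by apply: peq_catl; rewrite last_walk_of.
  exact: peq_catr.
move=> Hu Hv e; have := wlog_ne (h1 :: u) (h1 :: v) isT isT.
by apply=> //; [split=> //; exact: H1..|rewrite !big_cons e].
Qed.

Lemma nf_stack u : letters_in H u ->
  [/\ stack (nf u), last h1 (nf u) = h1, (exists t, nf u = h1 :: t) &
      prodw letH (rev (nf u)) = prodw letH u].
Proof.
move=> Hu; have [||s l e] := @stack_run h1 [::] (walk_of u) => //; first exact: path_walk_of.
split=> //.
  by have [t] := run_cons h1 [::] (walk_of u); rewrite last_walk_of; exists t.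
by rewrite e prod_walk_of // /rev /= big_cons big_nil letH_1 !mul1g.
Qed.

(** * Shape and height of normal forms *)

(** Nothing pushed onto [U] forms a river at its head. *)
Definition summit (U : seq hterm) := forall y, push U y = y :: U.

Lemma run_desc x st w : path (fun a b => hheight b < hheight a) x w ->
  run (x :: st) w = rev w ++ x :: st.
Proof.
elim: w x st => //= y w IHw x st /andP[yx pw].
by rewrite push_down // IHw // rev_cons cat_rcons.
Qed.

Lemma run_asc x st w : summit (x :: st) -> path (fun a b => hheight a < hheight b) x w ->
  run (x :: st) w = rev w ++ x :: st /\ summit (rev w ++ x :: st).
Proof.
elim: w x st => //= y w IHw x st sx /andP[xy pw]; rewrite sx rev_cons cat_rcons.
by apply: IHw => // z; rewrite pushE [hheight y < hheight x]ltnNge (ltnW xy) /= andbF.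
Qed.

(** The rewriting stops at a summit: the part of a normal form up to a first
    peak survives multiplication on the right. *)
Lemma push_keep X U y : summit U -> U != [::] -> exists X', push (X ++ U) y = X' ++ U.
Proof.
move=> sU U0; elim: X y => [|c X IHX] y; first by exists [:: y]; rewrite /= sU.
case E : (X ++ U) IHX => [|p st] IHX.
  by move: U0; case: (U) (X) E => [|u U'] [].
rewrite /= E pushE; case: ifP => _; last by exists [:: y, c & X]; rewrite /= E.
case: eqP => _; first by exists X.
by have [X' ->] := IHX (htri p c y); exists (y :: X').
Qed.

Lemma run_keep X U w : summit U -> U != [::] -> exists X', run (X ++ U) w = X' ++ U.
Proof.
move=> sU U0; elim: w X => [|y w IHw] X /=; first by exists X.
by have [X' ->] := push_keep X y sU U0.
Qed.

Notation bounded n := (all (fun h => hheight h <= n)).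

Lemma push_bounded n st y : bounded n (push st y) -> bounded n st && (hheight y <= n).
Proof.
elim: st y => [|c st IHst] y; first by rewrite /push /= andbT.
case: st IHst => [|p st] IHst; first by rewrite /push /= andbC.
rewrite pushE; case: ifP => [/andP[cy cp]|_]; last by rewrite /= andbC.
case: eqP => [<- b|py].
  move: (b) => /= /andP[pn _]; rewrite /= in b; rewrite /= b pn.
  by rewrite (leq_trans (ltnW cp) pn).
move=> /= /andP[yn /IHst/= /andP[-> _]]; rewrite yn.
by rewrite (leq_trans (ltnW cy) yn).
Qed.

(** Letters are removed only next to a higher letter that stays, so the maximal
    height of a normal form never drops under multiplication. *)
Lemma run_bounded n st w : bounded n (run st w) -> bounded n st && bounded n w.
Proof.
elim: w st => [|y w IHw] st /=; first by rewrite andbT.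
by move=> /IHw/andP[/push_bounded/andP[-> ->] ->].
Qed.

Lemma size_up h : H h -> size (up h) = hheight h.
Proof.
elim: h => // r _ b IHb l _ Hh; have [_ _ bb _ _] := H_triP Hh.
by rewrite /= -/(up b) size_cat IHb ?addn2 ?(hheight_below bb) //; exact: below_H bb.
Qed.

Lemma up_asc h : H h -> path (fun a b => hheight a < hheight b) h1 (up h).
Proof.
elim: h => // r _ b IHb l _ Hh; have [_ bl bb bbl _] := H_triP Hh.
rewrite /= -/(up b) cat_path last_up IHb /=; last exact: below_H bb.
by have := hheight_below bl; rewrite /= (hheight_below bbl) => ->; rewrite !ltnSn.
Qed.

Lemma down_desc h : H h -> path (fun a b => hheight b < hheight a) h (down h).
Proof.
elim: h => // r _ b IHb l _ Hh; have [_ bl bb bbl _] := H_triP Hh.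
by rewrite /= -/(down b) (hheight_below bb) !ltnSn /= IHb //; exact: below_H bb.
Qed.

Lemma asc_bounded x w : path (fun a b => hheight a < hheight b) x w ->
  bounded (hheight (last x w)) (x :: w).
Proof.
elim: w x => [|y w IHw] x /=; first by rewrite leqnn.
case/andP=> xy /IHw/= /andP[yl ->]; rewrite yl /= andbT.
exact: leq_trans (ltnW xy) yl.
Qed.

Lemma desc_bounded x w : path (fun a b => hheight b < hheight a) x w ->
  bounded (hheight x) (x :: w).
Proof.
elim: w x => [|y w IHw] x /=; rewrite leqnn //=.
case/andP=> xy /IHw/= /andP[_ b]; rewrite (ltnW xy) /=.
by apply: sub_all b => z zy; apply: leq_trans (ltnW xy).
Qed.

(** The letters of a walk, each expanded to its own walk from [h1], give back
    the walk: the way between consecutive letters shrinks to one step. *)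
Lemma peq_walk_of_walk x w : path adj x w ->
  peq x (down x ++ walk_of w) (w ++ down (last x w)).
Proof.
elim: w x => [|y w IHw] x /=; first by rewrite /walk_of cats0.
case/andP=> /adjP xy /IHw e; rewrite walk_of_cons.
apply: peq_trans (peq_step _ xy) _; exact: peq_cons.
Qed.

Lemma path_H x w : path adj x w -> letters_in H w.
Proof.
elim: w x => //= y w IHw x /andP[xy /IHw Hw]; split=> //.
by have [] := adj_H xy.
Qed.

(** The last clause allows replacing [walk_of u] by its mountain in the middle
    of a longer walk, where [nf] alone would not apply. *)
Lemma mountain_of (u : seq hterm) : letters_in H u -> exists w,
  [/\ nf u = rev (h1 :: w), path adj h1 w, last h1 w = h1 &
      prodw letH w = prodw letH u /\ peq h1 (walk_of u) w].
Proof.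
move=> Hu; have [s l [t E] e] := nf_stack Hu.
have [w Ew] : exists w, rev (nf u) = h1 :: w.
  move: l; rewrite E; case/lastP: t {E} => [|t x] /=; first by exists [::].
  by rewrite last_rcons => ->; exists (rev (h1 :: t)); rewrite -rcons_cons rev_rcons.
have Er : nf u = rev (h1 :: w) by rewrite -Ew revK.
have pw : path adj h1 w.
  have : sorted adj (rev (nf u)).
    rewrite rev_sorted (eq_sorted (e' := adj)); first by case/andP: s.
    by move=> x y; rewrite adj_sym.
  by rewrite Ew.
have lw : last h1 w = h1.
  have : last h1 (h1 :: w) = h1 by rewrite -Ew E rev_cons last_rcons.
  by [].
have ew : prodw letH w = prodw letH u.
  by rewrite -e Ew big_cons letH_1 mul1g.
exists w; split=> //; split=> //.
have := peq_walk_of Hu (path_H pw) (esym ew) => /peq_trans; apply.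
by have := peq_walk_of_walk pw; rewrite lw /= cats0.
Qed.

(** Going up after going down would create a river. *)
Lemma descent a b s : stack [:: a, b & s] -> hheight b < hheight a ->
  path (fun a b => hheight b < hheight a) a (b :: s).
Proof.
elim: s a b => [|d s IHs] a b st ba; rewrite /= ba //.
apply: IHs (stack_cons st) _; case/andP: st => /= /and3P[_ bd _].
case: (adj_hheight bd) => [e|->]; last by rewrite ltnSn.
by rewrite riverlessE ba e ltnSn.
Qed.

Lemma size_descent a b s : stack [:: a, b & s] -> hheight b < hheight a ->
  last b s = h1 -> size (b :: s) = hheight a.
Proof.
elim: s a b => [|d s IHs] a b st ba /=.
  case/andP: st => /= /andP[ab _] _ b0.
  by case: (adj_hheight ab) ba => [->|->]; rewrite ?b0 // ltnNge leqnSn.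
have /= /and3P[_ db _] := descent st ba.
move=> /(IHs b d (stack_cons st) db)/= ->.
case/andP: st => /= /andP[ab _] _.
by case: (adj_hheight ab) ba => [->|->]; rewrite // ltnNge leqnSn.
Qed.

Lemma cat_inj_size (T : eqType) (s1 s2 s3 s4 : seq T) :
  s1 ++ s2 = s3 ++ s4 -> size s2 = size s4 -> s2 = s4.
Proof.
move=> e ss; have /eqP := congr1 size e; rewrite !size_cat ss eqn_add2r => /eqP s13.
by move/eqP: e; rewrite eqseq_cat // => /andP[_ /eqP].
Qed.

Lemma summit1 : summit [:: h1]. Proof. by []. Qed.

(** * Rigidity *)

Section Rigid.
Variables (r c l : hterm) (w : seq hterm).
Hypothesis Hh : H (htri r c l).
Let t := rev (h1 :: w).
Hypotheses (st : stack t) (pw : path adj h1 w) (lw : last h1 w = h1).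
Hypothesis tw : run [:: h1] w = t.
Let h := htri r c l.
Let s := prodw letH w.
Hypothesis sl : letH c * letH l * s = s.
Hypothesis sr : s * letH r * letH c = s.
Hypothesis srcl : letH r * letH c * s * letH c * letH l =
                  letH r * letH c * letH l.

Let brh : below r h. Proof. by case: (H_triP Hh). Qed.
Let blh : below l h. Proof. by case: (H_triP Hh). Qed.
Let bcr : below c r. Proof. by case: (H_triP Hh). Qed.
Let bcl : below c l. Proof. by case: (H_triP Hh). Qed.
Let rl : r <> l. Proof. by case: (H_triP Hh) => _ _ _ _ /nesym. Qed.
Let Hr : H r. Proof. exact: below_H brh. Qed.
Let Hc : H c. Proof. exact: below_H bcr. Qed.
Let Hl : H l. Proof. exact: below_H blh. Qed.
Let Hw : letters_in H w. Proof. exact: path_H pw. Qed.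

Let Bw v : peq h1 (walk_of w ++ v) (w ++ v).
Proof. by apply: peq_catr; have := peq_walk_of_walk pw; rewrite lw /= cats0. Qed.

Let run_up g : H g ->
  run [:: h1] (up g) = rev (h1 :: up g) /\ summit (rev (h1 :: up g)).
Proof.
move=> Hg; have [-> ss] := run_asc summit1 (up_asc Hg).
by rewrite rev_cons -cats1.
Qed.

(* Since [c l s = s], the mountain [w] of [s] begins like that of [c l], which
   climbs from [h1] to [c] and then to the summit [l]. *)
Let prefix_l : exists X, t = X ++ l :: rev (h1 :: up c).
Proof.
have [e ss] := run_up Hc.
have e' : run [:: h1] (rcons (up c) l) = l :: rev (h1 :: up c).
  by rewrite -cats1 run_cat e /run /= ss.
have ss' : summit (l :: rev (h1 :: up c)).
  have := run_asc summit1 (w := rcons (up c) l); rewrite e' => -[|<-] //.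
  by rewrite rcons_path up_asc //= last_up (hheight_below bcl).
have E : peq h1 (walk_of [:: c, l & w]) (rcons (up c) l ++ down l ++ walk_of w).
  rewrite !walk_of_cons cat_rcons; apply: peq_up.
  exact: (peq_step _ (or_introl bcl)).
have E' : peq h1 (walk_of [:: c, l & w]) (w ++ [::]).
  apply: peq_trans (Bw [::]); rewrite cats0; apply: peq_walk_of => //.
  by rewrite !big_cons mulgA.
have : t = run [:: h1] (walk_of [:: c, l & w]) by rewrite E' cats0.
rewrite E run_cat e' => ->; exact: (run_keep [::]).
Qed.

(* Since [s r c = s], the mountain [w] ends like that of [r c]: letters below
   the last one are pushed without any rewriting. *)
Let suffix_r : exists Y, t = rev (down c) ++ [:: c, r & Y].
Proof.
have E : peq h1 (walk_of (w ++ [:: r; c])) ((walk_of w ++ up r) ++ c :: down c ++ [::]).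
  rewrite walk_of_cat !walk_of_cons -catA.
  apply: peq_catl; rewrite last_walk_of; apply: peq_up.
  exact: (peq_step _ (or_intror bcr)).
have E' : peq h1 (walk_of (w ++ [:: r; c])) (w ++ [::]).
  apply: peq_trans (Bw [::]); rewrite cats0; apply: peq_walk_of => //.
    exact: letters_in_cat.
  by rewrite big_cat /= !big_cons big_nil mulg1 mulgA.
have : t = run [:: h1] (walk_of (w ++ [:: r; c])) by rewrite E' cats0.
rewrite E cats0 run_cat; have [Y ->] := run_cons h1 [::] (walk_of w ++ up r).
rewrite last_cat last_walk_of last_up run_desc; last first.
  by rewrite /= (hheight_below bcr) ltnSn down_desc.
by rewrite rev_cons cat_rcons => ->; exists Y.
Qed.

(* The product [r c s c l] equals [r c l], whose river is filled in by [h]. *)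
Let sandwich_peq u : letters_in H u -> prodw letH u = s ->
  peq h1 (walk_of ([:: r; c] ++ u ++ [:: c; l])) (up r ++ [:: h, l & down l]).
Proof.
move=> Hu us.
apply: (@peq_trans _ (walk_of [:: r; c; l])).
  apply: peq_walk_of => //=.
    by do 2!split=> //; apply: letters_in_cat.
  by rewrite !big_cons big_cat /= us !big_cons big_nil !mulg1 !mulgA srcl.
apply: peq_trans (peq_rcl _ Hh) _; rewrite /walk_of /= cats0.
by apply: peq_up; exact: peq_turn.
Qed.

Let sandwich_run : run [:: h1] (up r ++ [:: h, l & down l]) =
  rev (down l) ++ l :: h :: rev (h1 :: up r).
Proof.
have [e ss] := run_up Hr; rewrite run_cat e.
rewrite /= ss -/(run _ _) push_down ?(hheight_below blh) // -/(run _ _).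
by rewrite run_desc // down_desc.
Qed.

Let sandwich_bounded : bounded (hheight h) (run [:: h1] (up r ++ [:: h, l & down l])).
Proof.
rewrite sandwich_run all_cat all_rev.
have := asc_bounded (up_asc Hr); rewrite last_up -all_rev => bu.
have /= /andP[_ bd] := desc_bounded (down_desc Hl).
have [lh rh] : hheight l <= hheight h /\ hheight r <= hheight h.
  by rewrite {1}(hheight_below blh) (hheight_below brh) !leqnSn.
apply/and4P; split.
- by apply: sub_all bd => z zl; exact: leq_trans zl lh.
- exact: lh.
- exact: leqnn.
- by apply: sub_all bu => z zr; exact: leq_trans zr rh.
Qed.

Let walk_of_mid u v : peq h1 (walk_of (u ++ w ++ v)) (walk_of u ++ w ++ walk_of v).
Proof.
by rewrite !walk_of_cat; apply: peq_catl; rewrite last_walk_of; exact: Bw.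
Qed.

(* As [s] is a factor of [r c s c l], its mountain is not higher than [h]. *)
Let t_bounded : bounded (hheight h) t.
Proof.
have := sandwich_bounded; rewrite -(sandwich_peq Hw (erefl s)) walk_of_mid.
by case/run_bounded/andP=> _; rewrite !all_cat /t all_rev => /and3P[_ /=].
Qed.

(* The mountain begins by climbing to [l], ends by going down from [r], and has
   height at most one more. If it turned back at [l], the two slopes would
   meet in one letter [l = r]; so a single letter [k] lies between them. *)
Let t_shape : exists k, [/\ below r k, below l k &
   t = rev (h1 :: up c ++ [:: l; k; r; c] ++ down c)].
Proof.
have [X tX] := prefix_l; have [Y tY] := suffix_r.
have lt : last h1 t = h1 by rewrite /t rev_cons last_rcons.
have stY : stack (r :: Y).
  move: st; rewrite tY; elim: (rev (down c)) => [/stack_cons //|z z' IHz].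
  by move/stack_cons.
have ltY : last r Y = h1 by move: lt; rewrite tY last_cat.
have szc : size (rev (h1 :: up c)) = hheight r.
  by rewrite size_rev /= size_up // (hheight_below bcr).
case: Y => [|k Y] in tY stY ltY.
  by move: ltY (hheight_below bcr) => /= ->.
have rk : adj r k by case/andP: stY => /andP[].
(* [t] is read from its end: [k] follows [r] when the walk is reversed. *)
case: (adj_hheight rk) => ek; last first.
  have ss : size (k :: Y) = hheight r by apply: size_descent stY _ _ => //; rewrite ek.
  have : [:: r, k & Y] = l :: rev (h1 :: up c).
    apply: (@cat_inj_size _ (rcons (rev (down c)) c) _ X).
      by rewrite cat_rcons -tY.
    by rewrite /= szc -ss.
  by case.
case: Y => [|d Y] in tY stY ltY.
  by move: ltY ek => /= ->.
have stY' := stack_cons stY.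
have kd : adj k d by case/andP: stY' => /andP[].
case: (adj_hheight kd) => ed.
  have : hheight d <= hheight h.
    by apply: (allP t_bounded); rewrite tY mem_cat !inE eqxx !orbT.
  by rewrite ed ek (hheight_below brh) ltnn.
have ss : size (d :: Y) = hheight k by apply: size_descent stY' _ _ => //; rewrite ed.
have E : d :: Y = l :: rev (h1 :: up c).
  apply: (@cat_inj_size _ (rev (down c) ++ [:: c; r; k]) _ X).
    by rewrite -catA -tY.
  by rewrite ss /= szc.
case: E tY kd ed => -> -> tY kd ed.
exists k; split.
- by apply: adj_below => //; rewrite ek.
- by apply: adj_below; rewrite ?ed // adj_sym.
- by rewrite tY -(cat_cons h1) !rev_cat -!catA.
Qed.

Lemma rigid_walk : s = letH h.
Proof.
have [k [brk blk tE]] := t_shape.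
have {tE} [wE] : h1 :: w = h1 :: up c ++ [:: l; k; r; c] ++ down c.
  by rewrite -[LHS]revK -/t tE revK.
have kh : k = h.
  (* Otherwise the river [h l k] in [r c s c l] would be filled in by a letter
     higher than [h]. *)
  apply: contrapT => /nesym hk.
  have Hcdc v : peq c (down c ++ up c ++ v) v by exact: peq_down_up.
  have E : peq h1 (walk_of ([:: r; c] ++ w ++ [:: c; l]))
      (up r ++ [:: h; htri h l k; k; r; h; l] ++ down l).
    apply: peq_trans (walk_of_mid _ _) _; rewrite wE !walk_of_cons /walk_of /= !cats0 -!catA.
    apply: peq_up; apply: peq_trans (peq_step _ (or_intror bcr)) _.
    apply: (@peq_trans _ [:: c, l, k, r, c & down c ++ up c ++ down c ++ up l ++ down l]).
      by apply: peq_cons; exact: peq_down_up.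
    apply: (@peq_trans _ [:: c, l, k, r, c, l & down l]).
      do 5!apply: peq_cons; apply: peq_trans (Hcdc _) _.
      exact: (peq_step _ (or_introl bcl)).
    apply: (@peq_trans _ [:: c, l, k, r, h, l & down l]).
      by do 4!apply: peq_cons; exact: peq_turn.
    apply: peq_trans (peq_turn _ bcr bcl rl) _; apply: peq_cons.
    exact: peq_turn.
  have := sandwich_bounded; rewrite -(sandwich_peq Hw (erefl s)) E.
  case/run_bounded/andP=> _; rewrite !all_cat => /and3P[_ /and3P[_ + _] _].
  by rewrite /= ltnn.
rewrite /s wE kh -(prod_peak Hh) /peak_path /= -/(up c) -/(down c) -!catA.
by rewrite !big_cat.
Qed.

End Rigid.

(** The premises make [s] absorb [c] on both sides, so the sandwich relation
    takes the shorter form without the factors [c] around [s]. *)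
Lemma rigid r c l (s : FI2m) : H (htri r c l) ->
  letH c * letH l * s = s -> s * letH r * letH c = s ->
  letH r * s * letH l = letH r * letH c * letH l ->
  s = letH (htri r c l).
Proof.
move=> Hh sl sr rsl; have Hc : H c by have [_ _ /below_H] := H_triP Hh.
have cs : letH c * s = s by rewrite -[in LHS]sl !mulgA letH_idem.
have sc : s * letH c = s by rewrite -[in LHS]sr -!mulgA letH_idem // !mulgA.
have [u Hu su] := letters_in_prod s.
have [w [E pw lw [ew e]]] := mountain_of Hu.
have [st _ _ _] := nf_stack Hu; rewrite E in st.
rewrite su -ew; apply: (rigid_walk Hh) => //; rewrite ?ew -?su //.
  by rewrite -E /nf e.
by rewrite -(mulgA _ (letH c) s) cs -(mulgA _ s (letH c)) sc.
Qed.

(** * Regularity of FI2 *)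

(** With [E] the product of a mountain and [F] that of its reversal, [F E]
    collapses step by step along a slope, since [p c p = p]. This is the second
    clause; it serves when [y] is above the letter before it, for the walk up
    to [y] is then a slope. *)
Lemma stack_regular y t : stack (y :: t) -> letters_in H (y :: t) ->
  let E := prodw letH (rev (y :: t)) in let F := prodw letH (y :: t) in
  E * F * E = E /\
  (path (fun a b => hheight b < hheight a) y t -> F * E = letH y).
Proof.
elim: t y => [|x t IHt] y sy [Hy Ht] /=.
  by rewrite !big_cons !big_nil !mulg1 !letH_idem.
have sx := stack_cons sy; have [IH1 IH2] := IHt x sx Ht.
rewrite (rev_cons y) -cats1 big_cat /= !(big_cons _ _ y) !big_nil !mulg1.
set E := prodw letH (rev (x :: t)) in IH1 IH2 *.
set F := prodw letH (x :: t) in IH1 IH2 *.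
have Hx : H x by case: Ht.
have Ex : E * letH x = E.
  by rewrite /E rev_cons -cats1 big_cat /= big_cons big_nil mulg1 -mulgA letH_idem.
have xF : letH x * F = F by rewrite /F big_cons mulgA letH_idem.
have yx : adj y x by case/andP: sy => /andP[].
have yFEy : hheight x < hheight y -> letH y * F * (E * letH y) = letH y.
  move=> xy; have /= /andP[_ px] := descent sy xy.
  rewrite mulgA -(mulgA (letH y)) (IH2 px) letH_back //.
  by apply: adj_below => //; rewrite adj_sym.
split; last by case/andP=> /yFEy.
case: (ltnP (hheight x) (hheight y)) => [xy|yx'].
  by rewrite -(mulgA E) (mulgA (letH y)) letH_idem // -mulgA (yFEy xy).
have b : below y x.
  by case: (adj_hheight yx) yx' => e; [move=> _; apply: adj_below; rewrite ?e|rewrite e ltnn].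
have e : E * (letH y * F) = E * F.
  have -> : E * F = E * (letH x * letH y * letH x) * F by rewrite letH_back // Ex.
  by rewrite -{1}Ex -{1}xF !mulgA.
by rewrite -(mulgA E) (mulgA (letH y)) letH_idem // e mulgA IH1.
Qed.

Lemma FI2m_regular (s : FI2m) : exists t, s * t * s = s.
Proof.
have [u Hu ->] := letters_in_prod s.
have [sn _ [t E] <-] := nf_stack Hu; rewrite E in sn *.
exists (prodw letH (h1 :: t)).
have [|//] := stack_regular sn; split; first exact: H1.
by apply: (@path_H h1); case/andP: sn.
Qed.

(** * Morphisms from F11 to regular monoids *)

(** A neighbour of [g] together with the label that leads from it to [g]. *)
Definition neighbour (g : term) (n : term) (b : A) :=
  (n, b) = (gl g, gla g) \/ (n, b) = (gr g, gra g).

Lemma invAK : involutive invA. Proof. by case. Qed.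

Lemma neighbour_inv g n b :
  (n, b) = (gl g, invA (gla g)) \/ (n, b) = (gr g, invA (gra g)) ->
  neighbour g n (invA b).
Proof. by case=> -[-> ->]; rewrite invAK; [left|right]. Qed.

Lemma G_1P g : G_ 1 g -> g = gxx'.
Proof.
move=> Hg; inversion Hg as [? ? E|? ? D]; subst; last by inversion D.
by inversion E as [|? ? E'|? ? E']; subst => //; inversion E'.
Qed.

(** [G_ 0] is empty, but 1 occurs as the centre of the letters of height 2. *)
Definition G0_ (i : nat) (c : term) := if i is 0 then c = atom A1 else G_ i c.

(** The letters in [Ge] and in [Gd] have the same shape: the centre, with the
    inverted label, is a common neighbour of the left and right letters. *)
Lemma G_SSP i g : G_ i.+2 g -> exists l a c b q,
  [/\ g = tup l a c b q, G_ i.+1 l, G_ i.+1 q, G0_ i c &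
      neighbour l c (invA a) /\ neighbour q c (invA b)].
Proof.
have Ge0 h : Ge i.+1 h -> G0_ i (gl h) /\ gr h = gl h.
  move=> E; inversion E as [|j k E'|j k E']; subst => //=.
    by split=> //; case: i E E' => [|i] E E'; [inversion E'|exact: G_e].
  by split=> //; case: i E E' => [|i] E E'; [inversion E'|exact: G_e].
move=> Hg; inversion Hg as [? ? E|? ? D]; subst.
  inversion E as [|j k E'|j k E']; subst; have [G0 e] := Ge0 k E'.
    exists k, (invA (gla k)), (gl k), (invA (gra k)), k.
    by split=> //; [exact: G_e..|rewrite !invAK /neighbour e; split; [left|right]].
  exists k, (invA (gra k)), (gl k), (invA (gla k)), k.
  by split=> //; [exact: G_e..|rewrite !invAK /neighbour e; split; [right|left]].
inversion D as [j p a c b q Gp Gc Gq pq ca cb]; subst.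
by exists p, a, c, b, q; split=> //; split; exact: neighbour_inv.
Qed.

Section Universal.
Variables (M : monoidType) (x x' : M).
Hypothesis regM : forall s : M, exists t, s * t * s = s.
Hypotheses (xx'x : x * x' * x = x) (x'xx' : x' * x * x' = x').

Definition valA (a : A) : M := match a with A1 => 1 | Ax => x | Ax' => x' end.

(** The relations of a letter with left and right letters [l] and [r] and centre
    [c]; [u], [v] are the values of its left and right labels, and [u'], [v']
    those of the inverse labels. *)
Definition sandwich (l u u' c v v' r s : M) :=
  [/\ s * s = s, c * u' * l * u * s = s, s * v' * r * v * c = s &
      r * v * s * u' * l = r * v * c * u' * l].

(** If [t] is an inverse of [m = v' r v c u' l u], then [c u' l u t v' r v c] is
    a solution: the sandwich relation is [m t m = m], up to the factors that
    the hypotheses allow to insert. *)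
Lemma sandwich_exists l u u' c v v' r :
  c * c = c -> l * u * c * u' * l = l -> r * v * c * v' * r = r ->
  l * u * u' * l = l -> r * v * v' * r = r ->
  exists s, sandwich l u u' c v v' r s.
Proof.
move=> cc lcl rcr ll rr.
have [m Em] : exists m, m = v' * r * v * c * u' * l * u by eexists.
have [t [mtm tmt]] : exists t, m * t * m = m /\ t * m * t = t.
  have [t mtm] := regM m; exists (t * m * t).
  have zm z : z * m * t * m = z * m by rewrite -{3}mtm !mulgA.
  by rewrite !mulgA !zm mtm.
have zcc z : z * c * c = z * c by rewrite -mulgA cc.
have zlcl z : z * l * u * c * u' * l = z * l by rewrite -{3}lcl !mulgA.
have zrcr z : z * r * v * c * v' * r = z * r by rewrite -{3}rcr !mulgA.
have zll z : z * l * u * u' * l = z * l by rewrite -{3}ll !mulgA.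
have zrr z : z * r * v * v' * r = z * r by rewrite -{3}rr !mulgA.
exists (c * u' * l * u * t * v' * r * v * c); split.
- by rewrite -{3}tmt Em !mulgA zcc.
- by rewrite !mulgA zlcl.
- by rewrite zrcr.
- transitivity (r * v * m * t * m * u' * l).
    by rewrite Em !mulgA rr zll.
  by rewrite -(mulgA _ m t) -(mulgA _ (m * t)) mtm Em !mulgA rr zll.
Qed.

(** [xget] chooses a solution of the relations of a letter, given the values of
    its components. *)
Fixpoint theta (g : term) : M :=
  match g with
  | atom a => valA a
  | tup l la c ra r =>
      if tup l la c ra r == gxx' then x * x' else
      xget 1 [set s | sandwich (theta l) (valA la) (valA (invA la)) (theta c)
                        (valA ra) (valA (invA ra)) (theta r) s]
  end.

(** [theta_down] and [theta_lab] say that stepping from [g] to a neighbour, or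
    only along its label, and back changes nothing, and [theta_neighbour] is
    [theta_lab] for the neighbour. The first two are the hypotheses of
    [sandwich_exists] for the letters above [g], and the last one serves to
    prove [theta_lab] for them. *)
Record theta_inv (i : nat) (g : term) : Prop := ThetaInv {
  theta_idem : theta g * theta g = theta g;
  theta_down : forall n b, neighbour g n b ->
    theta g * valA (invA b) * theta n * valA b * theta g = theta g;
  theta_lab : forall n b, neighbour g n b ->
    theta g * valA (invA b) * valA b * theta g = theta g;
  theta_neighbour : forall n b, 1 < i -> neighbour g n b ->
    theta n * valA b * valA (invA b) * theta n = theta n;
  theta_sandwich : 1 < i ->
    sandwich (theta (gl g)) (valA (gla g)) (valA (invA (gla g))) (theta (gc g))
             (valA (gra g)) (valA (invA (gra g))) (theta (gr g)) (theta g) }.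

(** The product [s (v' r v) c (u' l u) s] equals [s]: by the sandwich relation
    its factor [c] may be replaced by [s], and then each [s] absorbs its
    neighbours. The last two conclusions follow from it by absorption. *)
Lemma sandwich_down l u u' c v v' r s : c * c = c -> sandwich l u u' c v v' r s ->
  [/\ c * s = s, s * c = s, s * u' * l * u * s = s & s * v' * r * v * s = s].
Proof.
move=> cc [ss sl sr srl].
have cs : c * s = s by rewrite -[in LHS]sl !mulgA cc sl.
have sc : s * c = s by rewrite -[in LHS]sr -!mulgA cc !mulgA sr.
have full : s * v' * r * v * c * u' * l * u * s = s.
  have <- z : z * r * v * s * u' * l = z * r * v * c * u' * l.
    by have := congr1 (mul z) srl; rewrite !mulgA.
  transitivity (s * v' * r * v * c * s * (c * u' * l * u * s)).
    by rewrite !mulgA -(mulgA _ c s) cs -(mulgA _ s c) sc.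
  by rewrite sr sl ss ss.
split=> //; first by rewrite -[RHS]full sr.
by rewrite -[X in _ * X]sl !mulgA full.
Qed.

Lemma theta_invP i g : G_ i.+1 g -> theta_inv i.+1 g.
Proof.
elim/ltn_ind: i g => -[|i] IH g.
  move=> /G_1P ->; have e : theta gxx' = x * x' by rewrite /= eqxx.
  have ss : x * x' * (x * x') = x * x' by rewrite mulgA xx'x.
  split=> // [|n b|n b]; rewrite ?e //; case=> -[? ?]; subst=> /=;
    by rewrite ?mulg1 ?mul1g // !mulgA !xx'x.
move=> /G_SSP[l [a [c [b [q [-> Gl Gq Gc [nl nq]]]]]]].
have [il dl ll nnl _] := IH i (ltnSn i) l Gl.
have [iq dq lq nnq _] := IH i (ltnSn i) q Gq.
have cc : theta c * theta c = theta c.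
  case: i IH Gl Gq Gc nl nq {il dl ll nnl iq dq lq nnq} => [|i] IH _ _ Gc _ _.
    by rewrite Gc mulg1.
  by have [] := IH i (leqnSn i.+1) c Gc.
have sw : sandwich (theta l) (valA a) (valA (invA a)) (theta c)
             (valA b) (valA (invA b)) (theta q) (theta (tup l a c b q)).
  rewrite [theta (tup _ _ _ _ _)]/=; case: eqP => [[el _ _ _ _]|_].
    by have := G5_neq_atom A1 (ex_intro _ _ Gl); rewrite el eqxx.
  apply: (xgetPex 1); apply: sandwich_exists => //.
  - by have := dl _ _ nl; rewrite invAK.
  - by have := dq _ _ nq; rewrite invAK.
  - by have := ll _ _ nl; rewrite invAK.
  - by have := lq _ _ nq; rewrite invAK.
have [cs sc sls srs] := sandwich_down cc sw.
have [ss _ _ _] := sw.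
split=> //.
- by move=> n d [] [-> ->].
- move=> n d nd.
  set y := theta (tup l a c b q) in cs sc sls srs ss *.
  case: i IH Gl Gq Gc nl nq {il dl ll iq dq lq sw} nnl nnq => [|i] IH Gl Gq Gc nl nq nnl nnq.
    have [el eq] : theta l = x * x' /\ theta q = x * x'.
      by rewrite (G_1P Gl) (G_1P Gq) /= eqxx.
    (* The centre is 1, which absorbs no label; but the only label of a letter
       of height 2 other than 1 is [x], for which [x' (x x') x = x' x]. *)
    have key e : neighbour gxx' c (invA e) -> y * valA (invA e) * (x * x') * valA e * y = y ->
        y * valA (invA e) * valA e * y = y.
      case: e => -[] [] //= _; first by rewrite !mulg1 => _; exact: ss.
      have zx z : z * x' * x * x' = z * x' by rewrite -{3}x'xx' !mulgA.
      by rewrite !mulgA zx.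
    case: nd => -[_ ->] /=; apply: key.
    - by rewrite -(G_1P Gl).
    - by rewrite -el.
    - by rewrite -(G_1P Gq).
    - by rewrite -eq.
  (* Here the centre [c] is itself a letter, and [theta_neighbour] for [p]
     lets it absorb the label. *)
  have key p e : theta_inv i.+2 p -> neighbour p c (invA e) ->
      y * valA (invA e) * valA e * y = y.
    case=> _ _ _ nnp _ /(nnp _ _ isT); rewrite invAK => cec.
    rewrite -{1}sc -[X in _ * X]cs !mulgA.
    by rewrite -2!(mulgA y) -(mulgA y) cec sc ss.
  case: nd => -[? ->] /=; first exact: key _ _ (IH i.+1 (ltnSn _) l Gl) nl.
  exact: key _ _ (IH i.+1 (ltnSn _) q Gq) nq.
- move=> n d _ [] [-> ->].
    by have := ll _ _ nl; rewrite invAK.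
  by have := lq _ _ nq; rewrite invAK.
Qed.

Lemma G5_theta g : G5 g -> theta_inv (height g) g.
Proof.
move=> [i Gg]; rewrite (height_G Gg); case: i Gg => [Gg|i]; last exact: theta_invP.
by inversion Gg as [? ? E|? ? D]; [inversion E|inversion D].
Qed.

Lemma theta_rel u v : rhoG u v -> prodw theta u = prodw theta v.
Proof.
have e : theta gxx' = x * x' by rewrite /= eqxx.
case=> [|||g _|g _|g|g Gg g2|g Gg g2|g Gg g2];
  rewrite !(big_cons, big_nil) ?mulg1 ?mul1g ?mulgA //.
- by case=> [/G5_theta[]//|->]; rewrite mulg1.
- by have [_ _ _ _ /(_ g2)[]] := G5_theta Gg.
- by have [_ _ _ _ /(_ g2)[]] := G5_theta Gg.
- by have [_ _ _ _ /(_ g2)[]] := G5_theta Gg.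
Qed.

(** The chosen values satisfy the defining relations by construction. *)
Lemma F11_universal : exists f : F11m -> M,
  [/\ forall s t, f (s * t) = f s * f t, f 1 = 1,
      f (letG Ax) = x & f (letG Ax') = x'].
Proof.
pose f := hom_of (fun g : letterG => theta (val g)) : F11m -> M.
have fR u v : relG u v -> prodw (fun g : letterG => theta (val g)) (letters u) =
    prodw (fun g : letterG => theta (val g)) (letters v).
  by move=> /theta_rel; rewrite !big_map.
have fg a : f (letG (atom a)) = valA a.
  rewrite /f /letG hom_of_class // big_cons big_nil mulg1 val_insubd.
  by rewrite atom_G.
exists f; split; [exact: hom_of_mul| |exact: (fg Ax)|exact: (fg Ax')].
by rewrite -letG_1; exact: (fg A1).
Qed.

End Universal.

(** * Relations between letters in F11 *)

Notation letA a := (letG (atom a)).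

Lemma G5_height g : G5 g -> exists i, height g = i.+1 /\ G_ i.+1 g.
Proof.
move=> [[|i] Gg]; last by exists i; rewrite (height_G Gg).
by inversion Gg as [? ? E|? ? D]; [inversion E|inversion D].
Qed.

Lemma G5_parts g : G5 g -> 2 <= height g -> [/\ G5 (gl g), G5 (gr g) & G' (gc g)].
Proof.
move=> /G5_height[[|i] [-> Gg]] // _.
have [l [a [c [b [q [-> Gl Gq Gc _]]]]]] := G_SSP Gg; split; [by exists i.+1..|].
by case: i Gc {Gg Gl Gq} => [->|i Gc]; [right|left; exists i.+1].
Qed.

Lemma G'_G g : G' g -> G g.
Proof. by case=> [|->]; [left|right; exists A1]. Qed.

Lemma G_atom a : G (atom a).
Proof. by right; exists a. Qed.

Lemma G5_G g : G5 g -> G g.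
Proof. by left. Qed.

#[local] Hint Resolve G_atom G5_G G'_G : core.

Lemma letG_idem g : G' g -> letG g * letG g = letG g.
Proof.
move=> Gg; have := letG_rel (rhoG_idem Gg) isT isT.
by rewrite !(big_cons, big_nil) !mulg1; apply; do !split; auto.
Qed.

Lemma letG_x : letA Ax * letA Ax' * letA Ax = letA Ax.
Proof.
have := letG_rel rhoG_x isT isT.
by rewrite !(big_cons, big_nil) !mulg1 !mulgA; apply; do !split; auto.
Qed.

Lemma letG_x' : letA Ax' * letA Ax * letA Ax' = letA Ax'.
Proof.
have := letG_rel rhoG_x' isT isT.
by rewrite !(big_cons, big_nil) !mulg1 !mulgA; apply; do !split; auto.
Qed.

Lemma G5_gxx' : G5 gxx'. Proof. by exists 1%N; left; constructor. Qed.

Lemma letG_xx' : letG gxx' = letA Ax * letA Ax'.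
Proof.
have := letG_rel rhoG_xx' isT isT.
by rewrite !(big_cons, big_nil) !mulg1; apply; do !split; auto; exact/G5_G/G5_gxx'.
Qed.

Section Gam.
Variable g : term.
Hypotheses (Gg : G5 g) (g2 : 2 <= height g).
Let Gl : G5 (gl g). Proof. by case: (G5_parts Gg g2). Qed.
Let Gr : G5 (gr g). Proof. by case: (G5_parts Gg g2). Qed.
Let Gc : G' (gc g). Proof. by case: (G5_parts Gg g2). Qed.

Lemma letG_l :
  letG (gc g) * letA (invA (gla g)) * letG (gl g) * letA (gla g) * letG g = letG g.
Proof.
have := letG_rel (rhoG_L Gg g2) isT isT.
by rewrite !(big_cons, big_nil) !mulg1 !mulgA; apply; do !split; auto.
Qed.

Lemma letG_r :
  letG g * letA (invA (gra g)) * letG (gr g) * letA (gra g) * letG (gc g) = letG g.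
Proof.
have := letG_rel (rhoG_R Gg g2) isT isT.
by rewrite !(big_cons, big_nil) !mulg1 !mulgA; apply; do !split; auto.
Qed.

Lemma letG_cl : letG (gc g) * letG g = letG g.
Proof. by rewrite -[in LHS]letG_l !mulgA letG_idem // letG_l. Qed.

Lemma letG_cr : letG g * letG (gc g) = letG g.
Proof. by rewrite -[in LHS]letG_r -!mulgA letG_idem // !mulgA letG_r. Qed.

Lemma letG_sandwich :
  letG (gr g) * letA (gra g) * letG g * letA (invA (gla g)) * letG (gl g) =
  letG (gr g) * letA (gra g) * letG (gc g) * letA (invA (gla g)) * letG (gl g).
Proof.
have := letG_rel (rhoG_sandwich Gg g2) isT isT.
by rewrite !(big_cons, big_nil) !mulg1 !mulgA; apply; do !split; auto.
Qed.

End Gam.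

(** * The correspondence between the two alphabets *)

(** The letter [h] of [FI2] is to become [lam' g lam], where [g] is [Phi h] and
    [lam], [lam'] are the label [lam h] and its inverse: [f = x'x] is the
    conjugate of [xx'] by [x], and a triple, which absorbs its centre, takes
    the label of the latter. Labels are trivial at even heights. *)
Fixpoint lam (h : hterm) : A :=
  match h with hf => Ax | htri _ b _ => lam b | _ => A1 end.

(** The product in [F11] of two labels one of which is 1. *)
Definition mulA (a b : A) : A := if a is A1 then b else a.

(** The labels of [Phi h] compare those of the neighbours of [h] with that of
    [h], which is that of the centre [b]. *)
Fixpoint Phi (h : hterm) : term :=
  match h with
  | h1 => A1
  | htri a b c => tup (Phi c) (mulA (lam c) (invA (lam b))) (Phi b)
                      (mulA (lam a) (invA (lam b))) (Phi a)
  | _ => gxx'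
  end.

Lemma lam_even i h : H_ i h -> ~~ odd i -> lam h = A1.
Proof. by elim=> //= j a b c _ _ _ IHb _ _ _ _; rewrite negbK. Qed.

Lemma lam_above p q : below p q -> odd (hheight p) -> lam q = A1.
Proof.
move=> b o; case: (b) => /H_hheight Hq _ _; apply: lam_even Hq _.
by rewrite (hheight_below b) /= o.
Qed.

Lemma lam_below p q : below p q -> lam p = A1 \/ lam q = A1.
Proof.
move=> b; case: (boolP (odd (hheight p))) => o; first by right; exact: lam_above o.
by left; apply: lam_even o; exact: H_hheight (below_H b).
Qed.

Lemma mulA_inv a b : a = A1 \/ b = A1 -> invA (mulA a (invA b)) = mulA b (invA a).
Proof. by case: a b => -[] []. Qed.

Lemma letA_below p q : below p q ->
  letA (lam p) * letA (invA (lam q)) = letA (mulA (lam p) (invA (lam q))).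
Proof. by case/lam_below=> ->; rewrite /= letG_1 ?mul1g ?mulg1; case: lam. Qed.

Lemma letA_below' p q : below p q ->
  letA (lam q) * letA (invA (lam p)) = letA (invA (mulA (lam p) (invA (lam q)))).
Proof.
move=> b; have l := lam_below b; rewrite mulA_inv //.
by case: l => ->; rewrite /= letG_1 ?mul1g ?mulg1; case: lam.
Qed.

Lemma neighbour_Phi p q : below p q ->
  neighbour (Phi q) (Phi p) (mulA (lam p) (invA (lam q))).
Proof.
case: q => [|||r b l] [] // _ _ [] -> /=; by [left|right|rewrite /neighbour /=; auto].
Qed.

Lemma height_Phi h : H h -> height (Phi h) = hheight h.
Proof.
elim: h => // r _ b _ l IHl Hh; have [br bl _ _ _] := H_triP Hh.
rewrite /= IHl; last exact: below_H bl.
by have := hheight_below bl; rewrite -(hheight_below bl).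
Qed.

Lemma hheight_tri r b l : H (htri r b l) ->
  [/\ hheight (htri r b l) = (hheight b).+2, hheight r = (hheight b).+1 &
      hheight l = (hheight b).+1].
Proof. by case/H_triP=> _ _ /hheight_below /= -> /hheight_below -> _. Qed.

(** [he] and [hf] have the same image and are told apart by [lam]. Above, the
    labels of the neighbours are recovered from the components of [Phi h]. *)
Lemma Phi_inj_lam h k : H h -> H k -> Phi h = Phi k -> lam h = lam k -> h = k.
Proof.
move=> Hh Hk e; have {e} [e eh] : Phi h = Phi k /\ hheight h = hheight k.
  by rewrite -(height_Phi Hh) -(height_Phi Hk) e.
elim: h k Hh Hk e eh => [|||r IHr b IHb l IHl] [|||r' b' l'] Hh Hk //;
  try by [have [+ _ _] := hheight_tri Hk => /= ->|have [+ _ _] := hheight_tri Hh => /= ->].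
have [eh er el] := hheight_tri Hh; have [ek er' el'] := hheight_tri Hk.
rewrite eh ek => + [eb]; rewrite eb in er el.
have [br bl bbr bbl _] := H_triP Hh; have [br' bl' bbr' bbl' _] := H_triP Hk.
move=> [Pl ll Pb lr Pr] /= lb.
have inj p p' q : p = A1 \/ q = A1 -> p' = A1 \/ q = A1 ->
    mulA p (invA q) = mulA p' (invA q) -> p = p'.
  by case: p; case: p'; case: q; intuition discriminate.
rewrite -lb in ll lr.
have -> : r = r'.
  apply: IHr (below_H br) (below_H br') Pr _ _; first by rewrite er er'.
  by apply: (inj _ _ (lam b)) lr; [exact: lam_below br|rewrite lb; exact: lam_below br'].
have -> : l = l'.
  apply: IHl (below_H bl) (below_H bl') Pl _ _; first by rewrite el el'.
  by apply: (inj _ _ (lam b)) ll; [exact: lam_below bl|rewrite lb; exact: lam_below bl'].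
by rewrite (IHb _ (below_H bbr) (below_H bbr') Pb eb lb).
Qed.

(** From height 2 on, [lam] can be read off [Phi h]: it is trivial at even
    heights, and at odd heights the label of the left neighbour is, so that the
    component [gla] is the inverse of [lam h]. *)
Lemma Phi_inj h k : H h -> H k -> 2 <= hheight h -> Phi h = Phi k -> h = k.
Proof.
move=> Hh Hk h2 e; apply: Phi_inj_lam => //.
have eh : hheight h = hheight k by rewrite -(height_Phi Hh) -(height_Phi Hk) e.
case: h k Hh Hk e h2 eh => [|||r b l] [|||r' b' l'] Hh Hk e h2 //;
  try by move=> eh; rewrite eh in h2.
have [-> _ _] := hheight_tri Hh; have [-> _ _] := hheight_tri Hk => -[eb].
have [_ bl _ bbl _] := H_triP Hh; have [_ bl' _ bbl' _] := H_triP Hk.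
case: e => _ + _ _ _ /=.
have Hb := H_hheight (below_H bbl); have Hb' := H_hheight (below_H bbl').
case: (boolP (odd (hheight b))) => o; last by rewrite (lam_even Hb) // (lam_even Hb') -?eb.
rewrite (lam_above bbl) // (lam_above bbl') -?eb //=.
by case: (lam b) (lam b') => -[].
Qed.

Lemma neighbour_anchor g n b : neighbour g n b ->
  (n, invA b) = (gl g, invA (gla g)) \/ (n, invA b) = (gr g, invA (gra g)).
Proof. by case=> -[-> ->]; auto. Qed.

Lemma Phi_Gd_step i h :
  (forall j k, j < i.+2 -> H_ j.+1 k -> G_ j.+1 (Phi k)) ->
  H_ i.+3 h -> Gd i.+3 (Phi h).
Proof.
move=> IH Hh; inversion Hh as [| | |j a b c Ha Hb Hc ca _]; subst.
have [ba bc bba bbc _] := H_triP (ex_intro _ _ Hh : H (htri a b c)).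
rewrite /=; apply: Gd_tup; try exact: IH.
- move/Phi_inj => e; apply: ca; apply: e; rewrite ?(hheight_H_ Hc) //.
    exact: below_H bc.
  exact: below_H ba.
- have := neighbour_anchor (neighbour_Phi bbc); rewrite mulA_inv //.
  exact: lam_below bbc.
- have := neighbour_anchor (neighbour_Phi bba); rewrite mulA_inv //.
  exact: lam_below bba.
Qed.

Lemma Phi_G i h : H_ i.+1 h -> G_ i.+1 (Phi h).
Proof.
elim/ltn_ind: i h => -[|[|i]] IH h Hh.
- by left; inversion Hh; subst; constructor.
- inversion Hh as [| | |j a b c Ha Hb Hc ca _]; subst.
  by left; inversion Hb; inversion Ha; inversion Hc; subst; try by [case: ca];
    [exact: (Ge_step2 Ge_base)|exact: (Ge_step1 Ge_base)].
- by right; apply: Phi_Gd_step Hh => j k ji; exact: IH.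
Qed.

Lemma Phi_Gd i h : H_ i.+3 h -> Gd i.+3 (Phi h).
Proof. by apply: Phi_Gd_step => j k _; exact: Phi_G. Qed.

Lemma Phi_G' h : H h -> G' (Phi h).
Proof.
move=> /[dup] Hh /H_hheight; case e : (hheight h) => [|i] Hi.
  by rewrite (hheight_eq0 Hh e); right.
by left; exists i.+1; exact: Phi_G.
Qed.

(** * The morphism from FI2 to F11 *)

Definition psi (h : hterm) : F11m := letA (invA (lam h)) * letG (Phi h) * letA (lam h).

Lemma psi_1 : psi h1 = 1.
Proof. by rewrite /psi /= letG_1 !mulg1. Qed.

Lemma Phi_tri_G5 r b l : H (htri r b l) ->
  G5 (Phi (htri r b l)) /\ 2 <= height (Phi (htri r b l)).
Proof.
move=> Hh; have [e _ _] := hheight_tri Hh; split; last by rewrite height_Phi // e.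
by exists (hheight b).+2; apply: Phi_G; rewrite -e; exact: H_hheight.
Qed.

(** Conjugating by [lam h] loses nothing. The absorption property passes from
    the centre [b] to the triple, because the triple absorbs its centre. *)
Lemma psi_absorb h : H h ->
  letG (Phi h) * letA (lam h) * letA (invA (lam h)) = letG (Phi h) /\
  letA (lam h) * letA (invA (lam h)) * letG (Phi h) = letG (Phi h).
Proof.
elim: h => [|||r _ b IHb l _] Hh /=; try by rewrite letG_1 !(mulg1, mul1g).
  by rewrite letG_xx' !mulgA letG_x.
have [Gg g2] := Phi_tri_G5 Hh.
have [_ _ bb _ _] := H_triP Hh; have [b1 b2] := IHb (below_H bb).
have := (letG_cl Gg g2, letG_cr Gg g2); rewrite /=; set g := tup _ _ _ _ _ => -[cl cr].
split; first by rewrite -{1}cr -2!(mulgA (letG g)) b1.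
by rewrite -{1}cl mulgA b2.
Qed.

Lemma psi_idem h : H h -> psi h * psi h = psi h.
Proof.
move=> Hh; have [a1 _] := psi_absorb Hh; rewrite /psi !mulgA.
have z1 z : z * letG (Phi h) * letA (lam h) * letA (invA (lam h)) = z * letG (Phi h).
  by rewrite -{2}a1 !mulgA.
by rewrite z1 -(mulgA _ (letG (Phi h)) (letG (Phi h))) letG_idem //; exact: Phi_G'.
Qed.

Section PsiRelations.
Variables (r b l : hterm).
Hypothesis Hh : H (htri r b l).
Let h := htri r b l.
Let g := Phi h.
Let Gg : G5 g. Proof. by case: (Phi_tri_G5 Hh). Qed.
Let g2 : 2 <= height g. Proof. by case: (Phi_tri_G5 Hh). Qed.
Let bbr : below b r. Proof. by case: (H_triP Hh). Qed.
Let bbl : below b l. Proof. by case: (H_triP Hh). Qed.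

Let la := mulA (lam l) (invA (lam b)).
Let ra := mulA (lam r) (invA (lam b)).
Let el : letA (lam l) * letA (invA (lam b)) = letA la.
Proof. exact: letA_below (below_l Hh). Qed.
Let el' : letA (lam b) * letA (invA (lam l)) = letA (invA la).
Proof. exact: letA_below' (below_l Hh). Qed.
Let er : letA (lam r) * letA (invA (lam b)) = letA ra.
Proof. exact: letA_below (below_r Hh). Qed.
Let er' : letA (lam b) * letA (invA (lam r)) = letA (invA ra).
Proof. exact: letA_below' (below_r Hh). Qed.

Lemma psi_l : psi b * psi l * psi h = psi h.
Proof.
have := letG_l Gg g2; rewrite -[gl g]/(Phi l) -[gc g]/(Phi b) -[gla g]/la -el -el'.
rewrite /psi !mulgA -/g -[lam h]/(lam b) => e.
by rewrite -[in RHS]e !mulgA.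
Qed.

Lemma psi_r : psi h * psi r * psi b = psi h.
Proof.
have := letG_r Gg g2; rewrite -[gr g]/(Phi r) -[gc g]/(Phi b) -[gra g]/ra -er -er'.
rewrite /psi !mulgA -/g -[lam h]/(lam b) => e.
by rewrite -[in RHS]e !mulgA.
Qed.

Lemma psi_sandwich : psi r * psi b * psi h * psi b * psi l = psi r * psi b * psi l.
Proof.
have := letG_sandwich Gg g2; rewrite -[gr g]/(Phi r) -[gl g]/(Phi l) -[gc g]/(Phi b).
rewrite -[gla g]/la -[gra g]/ra -el' -er !mulgA => e.
have [b1 b2] := psi_absorb (below_H bbl).
have cl : letG (Phi b) * letG g = letG g := letG_cl Gg g2.
have cr : letG g * letG (Phi b) = letG g := letG_cr Gg g2.
have z1 z : z * letG (Phi b) * letA (lam b) * letA (invA (lam b)) = z * letG (Phi b).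
  by rewrite -{2}b1 !mulgA.
have z2 z : z * letG g * letA (lam b) * letA (invA (lam b)) * letG (Phi b) = z * letG g.
  by rewrite -2!(mulgA (z * letG g)) b2 -mulgA cr.
rewrite /psi -/g -[lam h]/(lam b) z1 z2.
rewrite -(mulgA _ (letG (Phi b)) (letG g)) cl.
by have := congr1 (fun z => letA (invA (lam r)) * z * letA (lam l)) e; rewrite !mulgA.
Qed.

End PsiRelations.

Lemma psi_rel u v : rhoH u v -> prodw psi u = prodw psi v.
Proof.
case=> [h _|h _|h Hh|i h i2 /(H_ge2 i2)[r [c [l [-> Hh]]]]
  |i h i2 /(H_ge2 i2)[r [c [l [-> Hh]]]]|i h i2 /(H_ge2 i2)[r [c [l [-> Hh]]]]] /=;
  rewrite !(big_cons, big_nil) ?psi_1 ?mulg1 ?mul1g //.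
- exact: psi_idem.
- by have := psi_l Hh; rewrite /psi !mulgA.
- by have := psi_r Hh; rewrite /psi !mulgA.
- by have := psi_sandwich Hh; rewrite /psi !mulgA.
Qed.

Definition Psi : FI2m -> F11m := hom_of (fun h : letterH => psi (val h)).

Lemma psi_relH u v : relH u v ->
  prodw (fun h : letterH => psi (val h)) (letters u) =
  prodw (fun h : letterH => psi (val h)) (letters v).
Proof. by move=> /psi_rel; rewrite !big_map. Qed.

Lemma Psi_mul s t : Psi (s * t) = Psi s * Psi t.
Proof. exact: (hom_of_mul psi_relH). Qed.

Lemma Psi_letH h : H h -> Psi (letH h) = psi h.
Proof.
move=> /mem_set Hh; rewrite /Psi /letH (hom_of_class psi_relH).
by rewrite big_cons big_nil mulg1 val_insubd Hh.
Qed.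

Lemma Psi_1 : Psi 1 = 1.
Proof. by rewrite -letH_1 Psi_letH ?psi_1 //; exact: H1. Qed.

Lemma Psi_prod u : letters_in H u -> Psi (prodw letH u) = prodw psi u.
Proof.
elim: u => [|h u IHu] /=; first by rewrite !big_nil Psi_1.
by case=> Hh Hu; rewrite !big_cons Psi_mul Psi_letH // IHu.
Qed.

(** * Injectivity *)

Fixpoint swap_ef (h : hterm) : hterm :=
  match h with
  | h1 => h1 | he => hf | hf => he
  | htri a b c => htri (swap_ef a) (swap_ef b) (swap_ef c)
  end.

Lemma swap_efK : involutive swap_ef.
Proof. by elim=> //= a -> b -> c ->. Qed.

Lemma swap_ef_H i h : H_ i h -> H_ i (swap_ef h).
Proof.
elim=> [|||j a b c _ Ha _ Hb _ Hc ca [bc ba]]; try by constructor.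
have sl k : hl (swap_ef k) = swap_ef (hl k) by case: k.
have sr k : hr (swap_ef k) = swap_ef (hr k) by case: k.
constructor=> //; first by move=> /(can_inj swap_efK).
by rewrite !sl !sr; split; [case: bc|case: ba] => ->; by [left|right].
Qed.

Lemma rhoH_swap_ef u v : rhoH u v -> rhoH (map swap_ef u) (map swap_ef v).
Proof.
have sl k : swap_ef (hl k) = hl (swap_ef k) by case: k.
have sr k : swap_ef (hr k) = hr (swap_ef k) by case: k.
have sc k : swap_ef (hc k) = hc (swap_ef k) by case: k.
have H_swp h : H h -> H (swap_ef h) by case=> i /swap_ef_H; exists i.
case=> [h /H_swp|h /H_swp|h /H_swp|i h i2 /swap_ef_H|i h i2 /swap_ef_H|i h i2 /swap_ef_H] Hh;
  rewrite /= ?sl ?sr ?sc; econstructor; eassumption.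
Qed.

Definition sigma : FI2m -> FI2m := hom_of (fun h : letterH => letH (swap_ef (val h))).

Lemma sigma_relH u v : relH u v ->
  prodw (fun h : letterH => letH (swap_ef (val h))) (letters u) =
  prodw (fun h : letterH => letH (swap_ef (val h))) (letters v).
Proof.
have e w : prodw (fun h : letterH => letH (swap_ef (val h))) (letters w) =
    prodw letH (map swap_ef (map val (letters w))) by rewrite !big_map.
have Hs (s : seq letterH) : letters_in H (map swap_ef (map val s)).
  by elim: s => //= h s IHs; split=> //; have [i /swap_ef_H] := set_mem (valP h); exists i.
move=> /rhoH_swap_ef/letH_rel; rewrite !e; apply=> //.
- by case: (u) => -[].
- by case: (v) => -[].
Qed.

Lemma sigma_mul s t : sigma (s * t) = sigma s * sigma t.
Proof. exact: (hom_of_mul sigma_relH). Qed.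

Lemma sigma_letH h : H h -> sigma (letH h) = letH (swap_ef h).
Proof.
move=> /mem_set Hh; rewrite /sigma [X in hom_of _ X]/letH (hom_of_class sigma_relH).
by rewrite big_cons big_nil mulg1 val_insubd Hh.
Qed.

Lemma sigma_1 : sigma 1 = 1.
Proof. by rewrite -{1}letH_1 sigma_letH ?letH_1 //; exact: H1. Qed.

Lemma sigmaK : involutive sigma.
Proof.
move=> s; have [u + ->] := letters_in_prod s.
elim: u => [|h u IHu] /=; first by rewrite !big_nil !sigma_1.
case=> Hh /IHu e; rewrite big_cons !sigma_mul e sigma_letH // sigma_letH ?swap_efK //.
by case: Hh => i /swap_ef_H; exists i.
Qed.

(** The semidirect product of [FI2m] and the group of order two generated by
    [sigma]. *)
Definition swap_prod : Type := (FI2m * bool)%type.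
HB.instance Definition _ := Choice.copy swap_prod (FI2m * bool)%type.

Definition swap_act (a : bool) (s : FI2m) := if a then sigma s else s.
Definition swap_mul (p q : swap_prod) : swap_prod := (p.1 * swap_act p.2 q.1, p.2 (+) q.2).

Lemma swap_act_mul a s t : swap_act a (s * t) = swap_act a s * swap_act a t.
Proof. by case: a; rewrite //= sigma_mul. Qed.

Lemma swap_act_add a b s : swap_act a (swap_act b s) = swap_act (a (+) b) s.
Proof. by case: a b => -[]; rewrite //= sigmaK. Qed.

Fact swap_mulA : associative swap_mul.
Proof.
move=> [p a] [q b] [r c]; rewrite /swap_mul /= addbA swap_act_mul swap_act_add.
by rewrite mulgA.
Qed.

Fact swap_mul1 : left_id (1, false) swap_mul.
Proof. by case=> p a; rewrite /swap_mul /= mul1g. Qed.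

Fact swap_mulr1 : right_id (1, false) swap_mul.
Proof. by case=> p a; rewrite /swap_mul /= addbF; case: a; rewrite /= ?sigma_1 mulg1. Qed.

HB.instance Definition _ := isMonoid.Build swap_prod swap_mulA swap_mul1 swap_mulr1.

Lemma swap_mulE (s t : FI2m) (a b : bool) :
  ((s, a) : swap_prod) * ((t, b) : swap_prod) = (s * swap_act a t, a (+) b) :> swap_prod.
Proof. by []. Qed.

(** [sigma] of an inverse of [s] gives an inverse of [s] times [sigma]. *)
Lemma swap_prod_regular (s : swap_prod) : exists t, s * t * s = s.
Proof.
case: s => s a; have [t e] := FI2m_regular s.
by exists (swap_act a t, a); rewrite !swap_mulE swap_act_add addbb /= e.
Qed.

(** The values [x = (e, true)] and [x' = (f, true)] are mutually inverse, with
    [xx' = e] and [x'x = f]. The image of a triple satisfies the relations of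
    that triple, so [rigid] identifies it; its boolean component is [false]
    by the sandwich relation, where all other factors have component
    [false]. *)
Lemma Psi_retraction : exists f : F11m -> swap_prod,
  forall s, f (Psi s) = (s, false).
Proof.
pose e := letH he; pose f := letH hf.
have ee : e * e = e := letH_idem He.
have ff : f * f = f := letH_idem Hf.
have se : sigma e = f := sigma_letH He.
have sf : sigma f = e := sigma_letH Hf.
pose x : swap_prod := (e, true); pose x' : swap_prod := (f, true).
have xx' : x * x' = (e, false) by rewrite swap_mulE /= sf ee.
have x'x : x' * x = (f, false) by rewrite swap_mulE /= se ff.
have [||F [FM F_1 Fx Fx']] := F11_universal swap_prod_regular (x := x) (x' := x').
- by rewrite xx' swap_mulE /= ee.
- by rewrite x'x swap_mulE /= ff.
exists F => s; have [u + ->] := letters_in_prod s.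
have Fi h : H h -> F (Psi (letH h)) = (letH h, false).
  elim: h => [|||r IHr c IHc l IHl] Hh.
  - by rewrite letH_1 Psi_1 F_1.
  - by rewrite Psi_letH // /psi /= letG_1 mul1g mulg1 letG_xx' FM Fx Fx' xx'.
  - rewrite Psi_letH // /psi /= letG_xx' !FM Fx Fx'.
    by rewrite (mulgA x') x'x -mulgA x'x swap_mulE /= ff.
  have [br bl bcr _ _] := H_triP Hh.
  have {}IHr := IHr (below_H br); have {}IHl := IHl (below_H bl).
  have {}IHc := IHc (below_H bcr).
  have := congr1 (F \o Psi) (letH_sandwich Hh).
  have := congr1 (F \o Psi) (letH_r Hh).
  have := congr1 (F \o Psi) (letH_l Hh).
  rewrite /= !Psi_mul !FM IHr IHc IHl; case: (F _) => y b.
  rewrite !swap_mulE /=; case: b => /= [_ _ []|] // [yl] [yr] [ys].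
  by congr (_, _); apply: rigid.
elim: u => [|h u IHu] /=; first by rewrite !big_nil Psi_1 F_1.
by case=> Hh /IHu e'; rewrite !big_cons Psi_mul FM Fi // e' swap_mulE.
Qed.

Lemma Psi_inj : injective Psi.
Proof. by have [f fK] := Psi_retraction; move=> s t /(congr1 f); rewrite !fK => -[]. Qed.

(** * The image is the set of mountains of F1 *)

Lemma odd_walk x w : path adj x w ->
  odd (hheight (last x w)) = odd (hheight x) (+) odd (size w).
Proof.
elim: w x => [|y w IHw] x /=; first by rewrite addbF.
case/andP=> /adj_hheight xy /IHw ->; case: xy => -> /=;
  by rewrite ?addNb ?addbN ?negbK.
Qed.

Lemma riverless_nth t i : riverless t -> i.+2 < size t ->
  ~~ ((hheight (nth h1 t i.+1) < hheight (nth h1 t i)) &&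
      (hheight (nth h1 t i.+1) < hheight (nth h1 t i.+2))).
Proof.
elim: i t => [|i IHi] [|x [|y [|z t]]] //; rewrite riverlessE => /andP[] // _ r.
exact: (IHi [:: y, z & t]).
Qed.

Lemma alternating_wordS n g a :
  alternating_word n.+1 g a = alternating_word n g a ++ [:: atom (a n.+1); g n.+1].
Proof.
by rewrite /alternating_word -[n.+1]addn1 iotaD map_cat flatten_cat /= add1n addn1.
Qed.

(** The atom between consecutive letters of an alternating word is the product
    of the labels that the conjugates under [psi] leave between them. *)
Lemma alternating_prod n g a hh : hh 0 = h1 ->
  (forall i, i <= n -> g i = Phi (hh i)) ->
  (forall i, 0 < i <= n ->
     letA (lam (hh i.-1)) * letA (invA (lam (hh i))) = letA (a i)) ->
  prodw letG (alternating_word n g a) * letA (lam (hh n)) = prodw psi (mkseq hh n.+1).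
Proof.
move=> h0; elim: n => [|n IHn] gP aP.
  rewrite big_cons big_nil gP // h0 /= big_cons big_nil !mulg1.
  by rewrite h0 /psi /= letG_1 !mulg1.
rewrite mkseqS -cats1 big_cat /= -IHn; first last.
- by move=> i /andP[i0 ni]; apply: aP; rewrite i0 leqW.
- by move=> i ni; apply: gP; exact: leqW.
rewrite alternating_wordS big_cat /= !big_cons !big_nil !mulg1 /psi !mulgA.
rewrite -(mulgA _ (letA (lam (hh n)))) (aP n.+1) ?leqnn //.
by rewrite (gP n.+1).
Qed.

Lemma H_2P h : H_ 2 h -> h = htri he h1 hf \/ h = htri hf h1 he.
Proof.
move=> Hh; inversion Hh as [| | |j a b c Ha Hb Hc ca _]; subst.
by inversion Hb; inversion Ha; inversion Hc; subst; try by [case: ca];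
  [left|right].
Qed.

Lemma H_1P h : H_ 1 h -> h = he \/ h = hf.
Proof. by move=> Hh; inversion Hh; auto. Qed.

Lemma Phi_Go i h : H_ i.+1 h -> Go_ i.+1 (Phi h).
Proof.
elim/ltn_ind: i h => -[|[|[|i]]] IH h.
- by move=> /H_1P[] ->.
- by move=> /H_2P[] ->; [right|left].
- move=> Hh; inversion Hh as [| | |j a b c Ha Hb Hc ca _]; subst.
  rewrite /= (lam_even Ha) // (lam_even Hc) //.
  exists (Phi c), (Phi a), (invA (lam b)).
  have -> : Phi b = gxx' by case: (H_1P Hb) => ->.
  split=> //; last by case: (H_1P Hb) => ->; [left|right].
  by case: (H_2P Ha) (H_2P Hc) ca => -> [] -> // _; rewrite [Phi _]/= // setUC.
- move=> Hh; have Gh := Phi_Gd Hh.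
  inversion Hh as [| | |j a b c Ha Hb Hc ca _]; subst.
  by split=> //; exact: IH.
Qed.

(** Only for [gxx'], the image of two letters, the neighbour does not determine
    the label. *)
Lemma neighbour_Phi_inv q n d : H q -> 2 <= hheight q -> neighbour (Phi q) n d ->
  exists p, [/\ below p q, n = Phi p & d = mulA (lam p) (invA (lam q))].
Proof.
case: q => // r b l Hq _; have [br bl _ _ _] := H_triP Hq.
by case=> -[-> ->]; [exists l|exists r].
Qed.

Lemma lam_dec h : lam h = A1 \/ lam h = Ax.
Proof. by elim: h => //=; auto. Qed.

Lemma Go_Phi i g : Go_ i.+1 g -> exists h, [/\ H h, hheight h = i.+1 & Phi h = g].
Proof.
have Ha : H (htri he h1 hf) by case: (H_valley below_e below_f).
have Hb : H (htri hf h1 he) by case: (H_valley below_f below_e).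
have ab : htri he h1 hf <> htri hf h1 he by [].
elim/ltn_ind: i g => -[|[|[|i]]] IH g.
- by move=> ->; exists he; split=> //; exact: He.
- by case=> ->; [exists (htri hf h1 he)|exists (htri he h1 hf)].
- case=> p [q [a [-> pq ea]]].
  have [k ek ak] : exists2 k, k = he \/ k = hf & a = invA (lam k).
    by case: ea => ->; [exists he; auto|exists hf; auto].
  have Pk : Phi k = gxx' by case: ek => ->.
  have ka : below k (htri he h1 hf) by split=> //; case: ek => ->; [right|left].
  have kb : below k (htri hf h1 he) by split.
  have [[-> ->]|[-> ->]] : p = g2e1 /\ q = g2e2 \/ p = g2e2 /\ q = g2e1.
    have [ep eq] : [set g2e1; g2e2] p /\ [set g2e1; g2e2] q.
      by rewrite -pq; split; [left|right].
    have [e1 e2] : [set p; q] g2e1 /\ [set p; q] g2e2.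
      by rewrite pq; split; [left|right].
    by case: ep eq e1 e2 => -> [] -> [] // _ [] //; auto.
  + have [Hh _ _] := H_valley ka kb ab.
    by exists (htri (htri he h1 hf) k (htri hf h1 he)); rewrite /= Pk ak.
  + have [Hh _ _] := H_valley kb ka (nesym ab).
    by exists (htri (htri hf h1 he) k (htri he h1 hf)); rewrite /= Pk ak.
- case=> Gg; inversion Gg as [j p a c b q _ _ _ pq ca cb]; subst=> /=.
  move=> /(IH _ (ltnSn _))[l [Hl el Pl]] /(IH _ (ltnSn _))[r [Hr er Pr]]; subst p q.
  have [|c1 [bcl Pc ec]] := neighbour_Phi_inv Hl _ (neighbour_inv ca); first by rewrite el.
  have [|c2 [bcr Pc' ec']] := neighbour_Phi_inv Hr _ (neighbour_inv cb); first by rewrite er.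
  have c12 : c1 = c2.
    apply: Phi_inj (below_H bcl) (below_H bcr) _ _; last by rewrite -Pc.
    by have := hheight_below bcl; rewrite el => -[<-].
  rewrite -{}c12 in bcr ec'.
  have rl : r <> l by move=> e; apply: pq; rewrite e.
  have [Hh _ _] := H_valley bcr bcl rl.
  exists (htri r c1 l); split=> //; first by rewrite /= er.
  rewrite /= Pc -(invAK a) ec -(invAK b) ec' !mulA_inv //; exact: lam_below.
Qed.

Lemma Phi_eq1 h : H h -> Phi h = atom A1 -> h = h1.
Proof. by move=> Hh e; apply: hheight_eq0 => //; rewrite -height_Phi // e. Qed.

Lemma Go1_Phi g : (Go `|` [set atom A1]) g -> exists2 h, H h & Phi h = g.
Proof.
case=> [[[|i] // /Go_Phi[h [Hh _ e]]]|->]; first by exists h.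
by exists h1 => //; exact: H1.
Qed.

Lemma Phi_Go1 h : H h -> (Go `|` [set atom A1]) (Phi h).
Proof.
move=> /[dup] Hh /H_hheight; case e : (hheight h) => [|i].
  by move=> _; right; rewrite (hheight_eq0 Hh e).
by move=> /Phi_Go; left; exists i.+1.
Qed.

Lemma letters_in_alternating n g a : (forall i, i <= n -> G' (g i)) ->
  letters_in G (alternating_word n g a).
Proof.
elim: n => [|n IHn] gG; first by split=> //; apply: G'_G; exact: gG.
rewrite alternating_wordS; apply: letters_in_cat.
  by apply: IHn => i ni; apply: gG; exact: leqW.
by split; [exact: G_atom|split=> //; apply: G'_G; exact: gG].
Qed.

Lemma Phi_G5 p q : below p q -> G5 (Phi q).
Proof.
case=> /H_hheight + + _; case: (hheight q) => // i Hq _.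
by exists i.+1; exact: Phi_G.
Qed.

(** A mountain of [FI2] becomes a word in [Mo] by applying [Phi] to its letters
    and inserting the quotients of successive labels. Condition (b) holds
    because the letters next to one of height 1 have even height, hence
    trivial labels. *)
Lemma F1o_Psi s : FI2 s -> F1o (Psi s).
Proof.
have [u Hu ->] := letters_in_prod s => u1.
have [w [E pw lw [ew _]]] := mountain_of Hu.
have [/andP[_ rl] _ _ _] := nf_stack Hu; rewrite E in rl.
have ow : ~~ odd (size w).
  by have := odd_walk pw; rewrite lw /= => <-.
pose n := (size w)./2.
have szw : n.*2 = size w by rewrite even_halfK.
pose hh i := nth h1 (h1 :: w) i.
pose a i := mulA (lam (hh i.-1)) (invA (lam (hh i))).
have Hhh i : H (hh i).
  rewrite /hh; have : letters_in H (h1 :: w) by split; [exact: H1|exact: path_H pw].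
  elim: (h1 :: w) i => [|x v IHv] [|i] //=; try (move=> _; exact: H1).
    by case.
  by case=> _ /IHv.
have adj_hh i : 0 < i <= n.*2 -> adj (hh i.-1) (hh i).
  case: i => // i /=; rewrite szw; exact: (pathP h1 pw).
have vh : prodw psi (mkseq hh n.*2.+1) = Psi (prodw letH u).
  rewrite /hh szw -[(size w).+1]/(size (h1 :: w)) mkseq_nth -ew Psi_prod.
    by rewrite big_cons psi_1 mul1g.
  exact: path_H pw.
have hn : hh n.*2 = h1 by rewrite /hh szw -[size w]/(size (h1 :: w)).-1 nth_last.
have [v Ev] : exists v : word letterG,
    map val (letters v) = alternating_word n.*2 (Phi \o hh) a.
  apply: word_of => //; apply: letters_in_alternating => i _; exact/Phi_G'.
exists v; last first.
  rewrite /clsG class_letG Ev -vh -(alternating_prod (g := Phi \o hh) (a := a)) //.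
    by rewrite hn letG_1 mulg1.
  move=> i /adj_hh/adjP; rewrite /a => -[b|b]; first exact: letA_below.
  by rewrite letA_below' // mulA_inv //; exact: lam_below.
exists n, (Phi \o hh), a; split=> //.
- split=> //.
  + split=> [i _|i /adj_hh/adjP[] b]; first exact: Phi_G'.
      by left; split; [exact: Phi_G'|exact: Phi_G5 b|exact: neighbour_Phi].
    right; split; [exact: Phi_G5 b|exact: Phi_G'|].
    by have := neighbour_anchor (neighbour_Phi b); rewrite mulA_inv //; exact: lam_below.
  + rewrite szw lt0n; apply: contra_not_neq u1 => /size0nil w0.
    by rewrite /= -ew w0 big_nil.
  + by rewrite -[LHS]/(Phi (hh n.*2)) hn.
  + move=> i [/andP[i0 ni]]; rewrite /= !height_Phi // => e1 e2.
    (* [rl] is about the reversed walk, in which a river at [i] is one at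
       [n.*2 - i]. *)
    have := riverless_nth (i := n.*2 - i.+1) rl.
    rewrite size_rev /= -szw !nth_rev /= -?szw; try lia.
    have -> : n.*2.+1 - (n.*2 - i.+1).+1 = i.+1 by lia.
    have -> : n.*2.+1 - (n.*2 - i.+1).+2 = i by lia.
    have -> : n.*2.+1 - (n.*2 - i.+1).+3 = i.-1 by lia.
    by rewrite -/(hh i.-1) -/(hh i) -/(hh i.+1) e1 e2 !ltnSn => /(_ _)/negP; apply; lia.
- by move=> i _; exact: Phi_Go1.
- move=> [|i] ni //; rewrite -[(Phi \o hh) _]/(Phi (hh i.+1)) height_Phi // => ei.
  have lam1 p : adj p (hh i.+1) -> lam p = A1.
    move=> pi; have [/H_hheight Hp _] := adj_H pi; apply: lam_even Hp _.
    by case: (adj_hheight pi) => [|->]; rewrite ei // => -[<-].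
  rewrite /a /= (lam1 (hh i)); last exact: (adj_hh i.+1 (ltnW ni)).
  rewrite (lam1 (hh i.+2)); last by rewrite adj_sym; exact: (adj_hh i.+2 ni).
  by rewrite /= invAK; case: lam.
Qed.

Lemma class_H_all1 (u v : word letterH) : class relH u = class relH v ->
  all (pred1 h1) (map val (letters u)) = all (pred1 h1) (map val (letters v)).
Proof.
move/classP/(_ (fun u v : word letterH =>
  all (pred1 h1) (map val (letters u)) = all (pred1 h1) (map val (letters v)))).
apply=> [|a b /rhoH_all1//]; split=> // [a b c -> //|a b c ab].
by rewrite !letters_mul !map_cat !all_cat ab.
Qed.

(** No defining relation identifies a word in the identity alone with another
    word. *)
Lemma FI2_prod h s : letters_in H s -> h \in s -> h <> h1 ->
  FI2 (prodw letH s).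
Proof.
move=> Hs hs hn1; have s0 : s != [::] by case: s hs {Hs}.
have [u Eu] := word_of s0 Hs; rewrite -Eu -class_letH => /class_H_all1.
by rewrite Eu /= eqxx => /allP/(_ h hs)/eqP.
Qed.

Lemma G5_not1 : ~ G5 (atom A1).
Proof. by move=> /(G5_neq_atom A1); rewrite eqxx. Qed.

Lemma Phi_gxx' h : H h -> hheight h < 2 -> G5 (Phi h) -> Phi h = gxx'.
Proof.
by case: h => [|||r b l] // => [_ _ /G5_not1 //|/hheight_tri[-> _ _]].
Qed.

Lemma letters_in_map (I T : Type) (X : set T) (f : I -> T) s :
  (forall i, X (f i)) -> letters_in X (map f s).
Proof. by move=> Xf; elim: s => //= i s IHs; split. Qed.

Section MountainsOfMo.
Variables (n : nat) (g : nat -> term) (a : nat -> A).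
Hypothesis land : forall i, 0 < i <= n ->
  left_anchored (g i.-1) (a i) (g i) \/ right_anchored (g i.-1) (a i) (g i).
Hypothesis g0 : g 0 = A1.
Hypothesis gGo : forall i, i <= n -> (Go `|` [set atom A1]) (g i).
Hypothesis ga : forall i, i < n -> height (g i) = 1%N -> a i.+1 = invA (a i).

(** The label before an occurrence of [gxx'] tells whether it comes from [he] or
    from [hf]. *)
Lemma height1_letter i : i <= n -> height (g i) = 1%N ->
  exists h, [/\ H h, g i = Phi h & lam h = invA (a i)].
Proof.
move=> ni gi; have i0 : 0 < i by case: i {ni} gi => //; rewrite g0.
have ii : 0 < i <= n by rewrite i0.
have [h Hh Ph] := Go1_Phi (gGo ni).
have [q Hq Pq] := Go1_Phi (gGo (leq_trans (leq_pred i) ni)).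
have Hh1 : H_ 1 h by have := H_hheight Hh; rewrite -height_Phi // Ph gi.
have Pg : g i = gxx' by rewrite -Ph; case: (H_1P Hh1) => ->.
have ai : a i = A1 \/ a i = Ax'.
  case: (land ii) => [[_ _]|[Gq _]]; first by rewrite Pg => -[] [_ ->]; auto.
  rewrite -Pq in Gq *; rewrite Pg => /neighbour_inv nbq.
  have q2 : 2 <= hheight q.
    case: (q) Hq Gq nbq => [|||r b l] Hq; first by move/G5_not1.
    - by move=> _ [].
    - by move=> _ [].
    - by have [-> _ _] := hheight_tri Hq.
  have [p [bp Pp ep]] := neighbour_Phi_inv Hq q2 nbq.
  have hq : hheight q = 2.
    by rewrite (hheight_below bp) -(height_Phi (below_H bp)) -Pp.
  have lq : lam q = A1 by apply: lam_even (H_hheight Hq) _; rewrite hq.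
  by move: ep; rewrite lq; case: (lam_dec p) => -> /=; case: (a i); auto.
rewrite Pg; case: ai => ->; [exists he|exists hf]; split=> //; [exact: He|exact: Hf].
Qed.

Lemma mountain_letters : exists hh, forall i, H (hh i) /\
  (i <= n -> g i = Phi (hh i) /\ (height (g i) = 1%N -> lam (hh i) = invA (a i))).
Proof.
suff /choice[hh hhP] : forall i, exists h, H h /\
  (i <= n -> g i = Phi h /\ (height (g i) = 1%N -> lam h = invA (a i))) by exists hh.
move=> i; case: (leqP i n) => ni; last by exists h1; split; [exact: H1|].
case: (eqVneq (height (g i)) 1%N) => gi.
  by have [h [Hh Ph lh]] := height1_letter ni gi; exists h.
have [h Hh Ph] := Go1_Phi (gGo ni).
by exists h; split=> // _; split=> // e; rewrite e in gi.
Qed.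

Variable hh : nat -> hterm.
Hypothesis Hhh : forall i, H (hh i).
Hypothesis Phh : forall i, i <= n -> g i = Phi (hh i).
Hypothesis lamhh : forall i, i <= n -> height (g i) = 1%N -> lam (hh i) = invA (a i).

Lemma hh_eq j p : j <= n -> H p -> g j = Phi p -> 2 <= hheight p -> hh j = p.
Proof.
move=> nj Hp gp p2; apply/esym; apply: Phi_inj => //.
by rewrite -gp Phh.
Qed.

(** At a letter of height at least 2, the neighbour that the anchoring condition
    provides is the adjacent letter, by injectivity of [Phi]. If that neighbour
    has height 1, only its image [gxx'] is known, but condition (b) and the
    choice made by [height1_letter] give the right label. *)
Lemma mountain_labels i : 0 < i <= n ->
  letA (lam (hh i.-1)) * letA (invA (lam (hh i))) = letA (a i).
Proof.
move=> ii; have [/andP[i0 ni]] := ii.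
have nj : i.-1 <= n by apply: leq_trans ni; exact: leq_pred.
have aj : height (g i.-1) = 1%N -> a i = invA (a i.-1).
  by have := @ga i.-1; rewrite prednK //; apply.
case: (land ii) => [[_ Gi nbi]|[Gj _ /neighbour_inv nbj]].
- case: (leqP 2 (hheight (hh i))) => [i2|i1].
    rewrite -/(neighbour (g i) (g i.-1) (a i)) [g i]Phh // in nbi.
    have [p [bp Pp ea]] := neighbour_Phi_inv (Hhh i) i2 nbi.
    have -> : lam (hh i.-1) = lam p; last by rewrite letA_below // -ea.
    case: (leqP 2 (hheight p)) => p2; first by rewrite (hh_eq nj (below_H bp)).
    have p1 : hheight p = 1%N.
      by move: i2 p2; rewrite (hheight_below bp); case: (hheight p) => [|[]].
    have gj : height (g i.-1) = 1%N by rewrite Pp height_Phi //; exact: below_H bp.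
    by rewrite lamhh // -aj // ea (lam_above bp) ?p1 //; case: (lam p).
  have gx : g i = gxx'.
    by rewrite Phh //; apply: Phi_gxx' => //; rewrite -Phh.
  have hj : hh i.-1 = h1.
    apply: Phi_eq1 => //; rewrite -Phh //.
    by move: nbi; rewrite gx => -[] [-> _].
  by rewrite hj letG_1 mul1g lamhh ?invAK // gx.
- case: (leqP 2 (hheight (hh i.-1))) => [j2|j1].
    rewrite [g i.-1]Phh // in nbj; have [p [bp Pp ea]] := neighbour_Phi_inv (Hhh i.-1) j2 nbj.
    have -> : lam (hh i) = lam p; last by rewrite letA_below' // -ea invAK.
    case: (leqP 2 (hheight p)) => p2; first by rewrite (hh_eq ni (below_H bp)).
    have p1 : hheight p = 1%N.
      by move: j2 p2; rewrite (hheight_below bp); case: (hheight p) => [|[]].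
    have gi : height (g i) = 1%N by rewrite Pp height_Phi //; exact: below_H bp.
    by rewrite lamhh // ea (lam_above bp) ?p1 //; case: (lam p).
  have gx : g i.-1 = gxx'.
    by rewrite Phh //; apply: Phi_gxx' => //; rewrite -Phh.
  have hi : hh i = h1.
    apply: Phi_eq1 => //; rewrite -Phh //.
    by move: nbj; rewrite gx => -[] [-> _].
  have gj : height (g i.-1) = 1%N by rewrite gx.
  by rewrite hi /= letG_1 mulg1 lamhh // aj.
Qed.

End MountainsOfMo.

Lemma F1o_sub_Psi s : F1o s -> exists2 q, FI2 q & s = Psi q.
Proof.
case=> v [n [g [a [Ev [[gG land] n1 g0 gn _] gGo ga]]]] ->.
have [hh hhP] := mountain_letters land g0 gGo.
have Hhh i : H (hh i) by case: (hhP i).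
have Phh i : i <= n.*2 -> g i = Phi (hh i) by case: (hhP i) => _ /[apply] -[].
have lamhh i : i <= n.*2 -> height (g i) = 1%N -> lam (hh i) = invA (a i).
  by case: (hhP i) => _ /[apply] -[].
have hh1 i : i <= n.*2 -> g i = A1 -> hh i = h1.
  by move=> ni gi; apply: Phi_eq1; rewrite // -Phh.
have Hs : letters_in H (mkseq hh n.*2.+1) by exact: letters_in_map.
exists (prodw letH (mkseq hh n.*2.+1)).
  apply: (@FI2_prod (hh 1%N)) => //; first by apply: map_f; rewrite mem_iota.
  move=> e; have e1 : g 1%N = A1 by rewrite Phh ?e.
  apply: G5_not1; case: (land 1%N n1) => [[_ G1 _]|[G0 _ _]]; first by rewrite -e1.
  by rewrite -g0.
rewrite Psi_prod // -(alternating_prod (g := g) (a := a)) //.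
- by rewrite hh1 // letG_1 mulg1 -Ev -class_letG.
- by apply: hh1.
- by move=> i; apply: (mountain_labels (n := n.*2) (g := g)).
Qed.

Lemma F1oE : F1o = Psi @` FI2.
Proof.
apply/seteqP; split=> s; first by case/F1o_sub_Psi=> q Fq ->; exists q.
by case=> q Fq <-; exact: F1o_Psi.
Qed.

(** * Weak generation and the main result *)

Lemma cls_xx'E : cls_xx' = Psi (letH he).
Proof.
rewrite Psi_letH; last exact: He.
rewrite /psi /= letG_1 mulg1 mul1g letG_xx' /cls_xx' /clsG class_letG.
by rewrite !big_cons big_nil mulg1.
Qed.

Lemma cls_x'xE : cls_x'x = Psi (letH hf).
Proof.
rewrite Psi_letH; last exact: Hf.
rewrite /psi /= letG_xx' !mulgA letG_x' /cls_x'x /clsG class_letG.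
by rewrite !big_cons big_nil mulg1.
Qed.

Lemma FI2_letH h : H h -> h <> h1 -> FI2 (letH h).
Proof.
move=> Hh n1; have := @FI2_prod h [:: h]; rewrite big_cons big_nil mulg1.
by apply=> //; rewrite inE.
Qed.

(** An inverse in the monoid may be the identity; then [s] is idempotent. *)
Lemma FI2_regular : regular FI2.
Proof.
move=> s Fs; have [t st] := FI2m_regular s.
case: (pselect (t = 1)) => [t1|Ft]; last by exists t.
by exists s => //; move: st; rewrite t1 mulg1 => e; rewrite [s * s]e [LHS]e.
Qed.

(** By induction the subsemigroup contains the components [r], [l], and [c]
    unless it is 1; by [rigid] the solution [c l t r c] of the relations of
    [(r,c,l)], with [t] an inverse of [r c l], is the letter itself. *)
Lemma FI2_weakly_generated (T : set FI2m) : regular_subsemigroup T ->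
  T (letH he) -> T (letH hf) -> FI2 `<=` T.
Proof.
move=> [Tm Tr] Te Tf s.
have Ti h : H h -> h <> h1 -> T (letH h).
  elim: h => [|||r IHr c IHc l IHl] // Hh _.
  have [br bl bcr _ _] := H_triP Hh.
  have [_ er el] := hheight_tri Hh.
  have Tir : T (letH r) by apply: IHr (below_H br) _ => e; rewrite e in er.
  have Til : T (letH l) by apply: IHl (below_H bl) _ => e; rewrite e in el.
  have Hc := below_H bcr; have cc := letH_idem Hc.
  have Tic : letH c = 1 \/ T (letH c).
    by case: (pselect (c = h1)) => [->|/(IHc Hc)]; [left; exact: letH_1|right].
  have Tcl t : T t -> T (letH c * t).
    by case: Tic => [->|Tc] Tt; [rewrite mul1g|exact: Tm].
  have Tcr t : T t -> T (t * letH c).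
    by case: Tic => [->|Tc] Tt; [rewrite mulg1|exact: Tm].
  pose m := letH r * letH c * letH l.
  have [t Tt mtm] : exists2 t, T t & m * t * m = m.
    by apply: Tr; apply: Tm Til; exact: Tcr.
  have [_ _ bcr' bcl _] := H_triP Hh.
  have zl z : z * letH l * letH c * letH l = z * letH l.
    by rewrite -{3}(letH_back bcl) !mulgA.
  have zr z : z * letH r * letH c * letH r = z * letH r.
    by rewrite -{3}(letH_back bcr) !mulgA.
  rewrite -(@rigid r c l (letH c * letH l * t * letH r * letH c)) //.
  - exact: (Tcr _ (Tm _ _ (Tm _ _ (Tcl _ Til) Tt) Tir)).
  - by rewrite !mulgA zl.
  - by rewrite zr.
  - by rewrite -[RHS]mtm /m !mulgA.
have [u Hu ->] := letters_in_prod s => Fs.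
have [e|//] : prodw letH u = 1 \/ T (prodw letH u); last by case: Fs.
elim: u Hu {Fs} => [|h u IHu] /=; first by left; rewrite big_nil.
case=> Hh /IHu{}IHu; rewrite big_cons.
case: (pselect (h = h1)) => [->|/(Ti h Hh) Th]; first by rewrite letH_1 mul1g.
by right; case: IHu => [->|Tu]; [rewrite mulg1|exact: Tm].
Qed.

Lemma F1o_isomorphic : isomorphic F1o FI2.
Proof.
have [f fP] := Psi_retraction.
have fK s : (f (Psi s)).1 = s by rewrite fP.
exists (fun s => (f s).1); rewrite F1oE; last first.
  by move=> _ _ [s _ <-] [t _ <-]; rewrite -Psi_mul !fK.
split.
- by move=> _ [s Fs <-]; rewrite fK.
- by move=> _ _ /set_mem[s _ <-] /set_mem[t _ <-]; rewrite !fK => ->.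
- by move=> s Fs; exists (Psi s); [exists s|exact: fK].
Qed.

Theorem corollary6p6 :
  [/\ F1o `<=` F1 /\ regular_subsemigroup F1o,
      idempotent_set [set cls_xx'; cls_x'x],
      weakly_generated F1o [set cls_xx'; cls_x'x] &
      isomorphic F1o FI2].
Proof.
have FI2e : FI2 (letH he) by apply: FI2_letH => //; exact: He.
have FI2f : FI2 (letH hf) by apply: FI2_letH => //; exact: Hf.
split; last exact: F1o_isomorphic.
- rewrite F1oE; split.
    move=> _ [s Fs <-] /= s1; apply: Fs; apply: Psi_inj.
    by rewrite s1 Psi_1.
  split=> [_ _ [s Fs <-] [t Ft <-]|_ [s /FI2_regular[t Ft e] <-]].
    by exists (s * t); [exact: FI2_subsemigroup|exact: Psi_mul].
  by exists (Psi t); [exists t|rewrite -!Psi_mul e].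
- move=> s /= [] ->; rewrite ?cls_xx'E ?cls_x'xE -Psi_mul letH_idem //.
    exact: He.
  exact: Hf.
split=> [s|T [Tm Tr] TF XT].
  by rewrite F1oE => -[] ->; rewrite ?cls_xx'E ?cls_x'xE; [exists (letH he)|exists (letH hf)].
apply/seteqP; split=> //; rewrite F1oE in TF *.
have Tre : regular_subsemigroup [set s | T (Psi s)].
  split=> [s t Ts Tt|s /= Ts]; first by rewrite /= Psi_mul; exact: Tm.
  have [_ /[dup] /TF[t Ft <-] Tt e] := Tr _ Ts.
  by exists t => //; apply: Psi_inj; rewrite !Psi_mul.
move=> _ [s Fs <-]; apply: (FI2_weakly_generated Tre) Fs.
- by rewrite /= -cls_xx'E; apply: XT; left.
- by rewrite /= -cls_x'xE; apply: XT; right.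
Qed.
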